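(* Let $s$ be a compound Poisson process (with some Poisson parameter $\lambda>0$) whose law of jumps $\mathcal{P}$ admits a probability density function, has zero mean and has finite variance. Let $\mathrm{MSE}_M^{\rm greedy}=\mathbb{E}\big[\|s-\mathrm{P}_M^{\rm greedy}(s)\|_{L_2([0,1])}^2\big]$ be the mean-squared error of the greedy Haar approximation of $s$ on $[0,1]$. Then for every $k\in\mathbb{N}$, $$\lim_{M\to+\infty} M^k\,\mathrm{MSE}_M^{\rm greedy}=0,$$ and for every $\alpha>0$, $$\lim_{M\to+\infty} e^{\alpha M}\,\mathrm{MSE}_M^{\rm greedy}=+\infty.$$
   Context: Compound Poisson process with parameters $(\mathcal{P},\lambda)$: let $\{\tau_k\}$ be a stationary Poisson point process on $\mathbb{R}$ with rate $\lambda>0$, and let $\{a_k\}$ be i.i.d. random variables with law $\mathcal{P}$, independent of $\{\tau_k\}$. Then $s$ is the piecewise-constant process with $s(0)=0$ and weak derivative $\sum_k a_k\delta(\cdot-\tau_k)$; for $t\in[0,1]$, $s(t)=\sum_{k:\,0<\tau_k\leq t}a_k$. All processes are restricted to $[0,1]$. Haar basis of $L_2([0,1])$: $\phi=\mathbb{1}_{[0,1]}$, $\psi=\mathbb{1}_{[0,1/2]}-\mathbb{1}_{[1/2,1]}$, $\psi_{j,k}=2^{j/2}\psi(2^j\cdot-k)$ for $j\geq 0$, $0\leq k\leq 2^j-1$. The orthonormal basis is $\{\phi\}\cup\{\psi_{j,k}\}_{j\geq 0,\,0\leq k\leq 2^j-1}$, ordered by the index $\mathrm{Ind}(\phi)=0$,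 $\mathrm{Ind}(\psi_{j,k})=2^j+k$. Greedy approximation: for $f\in L_2([0,1])$, $\mathrm{P}_M^{\rm greedy}(f)$ is the partial Haar expansion of $f$ obtained by keeping only the first $M$ nonzero coefficients among $\langle f,\phi\rangle,\langle f,\psi_{j,k}\rangle$ (first with respect to $\mathrm{Ind}$), and discarding all others; if $f$ has fewer than $M$ nonzero coefficients, all are kept. *)

(* Defs.v *)
From HB Require Import structures.
From mathcomp Require Import all_boot all_order all_algebra.
From mathcomp Require Import finmap.
From mathcomp Require Import all_classical all_reals all_analysis.
From mathcomp Require Import measurable_realfun.

Set Implicit Arguments.
Unset Strict Implicit.
Unset Printing Implicit Defensive.

Import Order.TTheory GRing.Theory Num.Theory.
Import numFieldNormedType.Exports.

Local Open Scope classical_set_scope.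
Local Open Scope ring_scope.

Section Independence.
Context {d : measure_display} {T : measurableType d} {R : realType}.
Variable P : probability T R.

Definition mutually_independent (d' : measure_display) (T' : measurableType d')
    (I : choiceType) (X : I -> T -> T') : Prop :=
  forall (F : {fset I}) (B : I -> set T'),
    (forall i, i \in F -> measurable (B i)) ->
    P (\bigcap_(i in [set` F]) (X i @^-1` B i)) =
    (\prod_(i <- F) P (X i @^-1` B i))%E.

(* The sigma-algebra on T generated by a sequence of real functions. *)
Definition sigma_of (X : nat -> T -> R) : set (set T) :=
  <<s [set E | exists k (B : set R), measurable B /\ E = X k @^-1` B] >>.

Definition independent_sequences (X Y : nat -> T -> R) : Prop :=
  forall E F, sigma_of X E -> sigma_of Y F ->
    P (E `&` F) = (P E * P F)%E.

End Independence.

Section CompoundPoisson.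
Context {d : measure_display} {T : measurableType d} {R : realType}.
Variable P : probability T R.

(* Points are counted by index, hence with multiplicity; the value is +oo when
   infinitely many of them lie in A. *)
Definition count_points (tau : nat -> T -> R) (A : set R) (w : T) : \bar R :=
  counting [set k | A (tau k w)].

(* A Poisson point process given by an arbitrary measurable enumeration of its
   points: tau k is not assumed to be nondecreasing in k.  The library's
   poisson_prob has a dummy second argument and is the Dirac mass at 0 when the
   rate vanishes (unlike poisson_pmf, which is then constantly 1). *)
Definition stationary_poisson_process (lambda : R)
    (tau : nat -> {RV P >-> R}) : Prop :=
  (forall (A : set R) (n : nat), measurable A ->
     (lebesgue_measure A < +oo)%E ->
     P [set w | count_points tau A w = n%:R%:E] =
     poisson_prob (lambda * fine (lebesgue_measure A)) 0 [set n]) /\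
  (forall A : nat -> set R,
     (forall i, measurable (A i)) ->
     (forall i, (lebesgue_measure (A i) < +oo)%E) ->
     trivIset setT A ->
     mutually_independent P (fun i => count_points tau (A i))).

Definition iid_with_law (law : probability R R)
    (a : nat -> {RV P >-> R}) : Prop :=
  (forall k (B : set R), measurable B -> distribution P (a k) B = law B) /\
  mutually_independent P (fun k => a k : T -> R).

Definition compound_poisson_data (law : probability R R) (lambda : R)
    (tau a : nat -> {RV P >-> R}) : Prop :=
  [/\ stationary_poisson_process lambda tau,
      iid_with_law law a &
      independent_sequences P (fun k => tau k : T -> R)
                              (fun k => a k : T -> R)].

(* The index set is finite for almost every w; the sum is 0 by convention when
   infinitely many of its terms are nonzero. *)
Definition compound_poisson (tau a : nat -> {RV P >-> R}) (w : T) (t : R) : R :=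
  \sum_(k \in [set k | 0 < tau k w <= t]) a k w.

End CompoundPoisson.

Definition has_density {R : realType} (law : probability R R) : Prop :=
  exists f : R -> R,
    [/\ measurable_fun setT f,
        (forall x, 0 <= f x) &
        forall A : set R, measurable A ->
          law A = (\int[lebesgue_measure]_(x in A) (f x)%:E)%E].

Section Haar.
Context {R : realType}.
Implicit Types f g : R -> R.

Definition haar_phi : R -> R := \1_(`[0, 1] : set R).

Definition haar_psi (x : R) : R :=
  \1_(`[0, 2^-1] : set R) x - \1_(`[2^-1, 1] : set R) x.

Definition haar_psi_jk (j k : nat) (x : R) : R :=
  Num.sqrt (2 ^+ j) * haar_psi (2 ^+ j * x - k%:R).

(* The basis listed by Ind: every n > 0 is 2 ^ j + k for a unique pair (j, k)
   with k < 2 ^ j, see haar_Ind. *)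
Definition haar (n : nat) : R -> R :=
  if n is 0%N then haar_phi
  else haar_psi_jk (trunc_log 2 n) (n - 2 ^ trunc_log 2 n)%N.

Lemma haar_Ind (j k : nat) : (k < 2 ^ j)%N ->
  haar (2 ^ j + k)%N = haar_psi_jk j k.
Proof.
move=> kj; have e : trunc_log 2 (2 ^ j + k) = j.
  apply: trunc_log_eq => //.
  by rewrite leq_addr /= expnS mul2n -addnn ltn_add2l.
have : (0 < 2 ^ j + k)%N by rewrite addn_gt0 expn_gt0.
have := addKn (2 ^ j) k; rewrite /haar; move: (2 ^ j + k)%N e.
by case=> [//|m] -> -> _.
Qed.

Definition inner01 f g : R :=
  \int[lebesgue_measure]_(x in `[0, 1]) (f x * g x).

Definition sqnorm01 f : \bar R :=
  (\int[lebesgue_measure]_(x in `[0%R, 1%R]) ((f x) ^+ 2)%:E)%E.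

Definition haar_coef f (n : nat) : R := inner01 f (haar n).

(* Indices of the nonzero coefficients preceded by fewer than M nonzero ones. *)
Definition greedy_indices (M : nat) f : set nat :=
  [set n | haar_coef f n != 0 /\ (\sum_(m < n) (haar_coef f m != 0%R) < M)%N].

Definition greedy (M : nat) f (x : R) : R :=
  \sum_(n \in greedy_indices M f) haar_coef f n * haar n x.

End Haar.

Definition mse_greedy {d : measure_display} {T : measurableType d}
    {R : realType} (P : probability T R) (s : T -> R -> R) (M : nat) : \bar R :=
  (\int[P]_w sqnorm01 (fun x => s w x - greedy M (s w) x)%R)%E.

(* Main.v *)
(* Between jumps the path is constant, so psi_(j,k) sees it only if a jump falls
   into the interior of its support: with n jumps in ]0, 1] there are at most n
   nonzero coefficients per scale.  Hence M >= 1 + J n terms contain all scales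
   below J, and the error is at most 2^-J n (sum of squared jumps), because
   the projection error of a single step 1_[t,1] at level J is
   2^J (t - l) (r - t) <= 2^-J, with [l, r] the dyadic interval around t.  With
   J = (M - 1) / (n + 1) this is O(M^-k 2^n (sum of squared jumps)) for each k,
   and Poisson variables have exponential moments.
   Conversely, fix q and suppose that each of the 2^q dyadic intervals of level q
   carries exactly one jump.  Then every scale from q on has 2^q nonzero
   coefficients, so M terms do not reach beyond scale q + L with L about M / 2^q,
   and the error is at least c 2^-L with positive probability independent of L.
   As q is arbitrary, the decay is slower than any exponential. *)

Require Import Defs.
From HB Require Import structures.
From mathcomp Require Import all_boot all_order all_algebra.
From mathcomp Require Import finmap.
From mathcomp Require Import all_classical all_reals all_analysis.
From mathcomp Require Import measurable_realfun.
From mathcomp Require Import ring lra zify.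

Import Order.TTheory GRing.Theory Num.Theory.
Import numFieldNormedType.Exports.

Set Implicit Arguments.
Unset Strict Implicit.
Unset Printing Implicit Defensive.

Local Open Scope classical_set_scope.
Local Open Scope ring_scope.

(** * The Haar system *)

Section InnerProduct.
Context {R : realType}.
Implicit Types f g h : R -> R.

Definition bounded_mfun f :=
  measurable_fun setT f /\ exists C, forall x, `|f x| <= C.

Lemma bounded_mfunD f g : bounded_mfun f -> bounded_mfun g ->
  bounded_mfun (fun x => f x + g x).
Proof.
move=> [mf [C fC]] [mg [D gD]]; split; first exact: measurable_funD.
by exists (C + D) => x; rewrite (le_trans (ler_normD _ _))// lerD.
Qed.

Lemma bounded_mfunM f g : bounded_mfun f -> bounded_mfun g ->
  bounded_mfun (fun x => f x * g x).
Proof.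
move=> [mf [C fC]] [mg [D gD]]; split; first exact: measurable_funM.
by exists (C * D) => x; rewrite normrM ler_pM.
Qed.

Lemma bounded_mfunZ (c : R) f : bounded_mfun f -> bounded_mfun (fun x => c * f x).
Proof.
move=> bf; apply: bounded_mfunM => //.
by split; [exact: measurable_cst|exists `|c|].
Qed.

Lemma bounded_mfunB f g : bounded_mfun f -> bounded_mfun g ->
  bounded_mfun (fun x => f x - g x).
Proof.
move=> bf bg; rewrite (_ : (fun x => _) = (fun x => f x + (-1) * g x)).
  by apply: bounded_mfunD => //; exact: bounded_mfunZ.
by apply/funext => x; rewrite mulN1r.
Qed.

Lemma bounded_mfun_sum (I : eqType) (r : seq I) (F : I -> R -> R) :
  (forall i, i \in r -> bounded_mfun (F i)) ->
  bounded_mfun (fun x => \sum_(i <- r) F i x).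
Proof.
elim: r => [|i r ih] bF.
  rewrite (_ : (fun x => _) = cst 0).
    by split; [exact: measurable_cst|exists 0 => x; rewrite normr0].
  by apply/funext => x; rewrite big_nil.
rewrite (_ : (fun x => _) = (fun x => F i x + \sum_(j <- r) F j x)).
  apply: bounded_mfunD; first by apply: bF; rewrite mem_head.
  by apply: ih => j jr; apply: bF; rewrite inE jr orbT.
by apply/funext => x; rewrite big_cons.
Qed.

Lemma bounded_mfun_integrable f : bounded_mfun f ->
  (@lebesgue_measure R).-integrable `[0, 1] (EFin \o f).
Proof.
move=> [mf [C fC]]; apply: measurable_bounded_integrable => //.
- by rewrite /= lebesgue_measure_itv/= lte_fin ltr01 -EFinB ltry.
- exact: measurable_funTS.
- exists C; split; first exact: num_real.
  by move=> D CD x _ /=; apply: (le_trans (fC x)); exact: ltW.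
Qed.

Lemma inner01C f g : inner01 f g = inner01 g f.
Proof. by apply: eq_Rintegral => x _; rewrite mulrC. Qed.

Lemma inner01Dl f g h : bounded_mfun f -> bounded_mfun g -> bounded_mfun h ->
  inner01 (fun x => f x + g x) h = inner01 f h + inner01 g h.
Proof.
move=> bf bg bh; rewrite /inner01.
under eq_Rintegral do rewrite mulrDl.
by rewrite RintegralD//; apply: bounded_mfun_integrable; exact: bounded_mfunM.
Qed.

Lemma inner01Zl (c : R) f h : bounded_mfun f -> bounded_mfun h ->
  inner01 (fun x => c * f x) h = c * inner01 f h.
Proof.
move=> bf bh; rewrite /inner01.
under eq_Rintegral do rewrite -mulrA.
by rewrite RintegralZl//; apply: bounded_mfun_integrable; exact: bounded_mfunM.
Qed.

Lemma inner01Bl f g h : bounded_mfun f -> bounded_mfun g -> bounded_mfun h ->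
  inner01 (fun x => f x - g x) h = inner01 f h - inner01 g h.
Proof.
move=> bf bg bh; rewrite (_ : (fun x => _) = (fun x => f x + (-1) * g x)).
  by rewrite inner01Dl ?inner01Zl ?mulN1r//; exact: bounded_mfunZ.
by apply/funext => x; rewrite mulN1r.
Qed.

Lemma inner01_suml (I : eqType) (r : seq I) (c : I -> R) (F : I -> R -> R) h :
  (forall i, i \in r -> bounded_mfun (F i)) -> bounded_mfun h ->
  inner01 (fun x => \sum_(i <- r) c i * F i x) h =
  \sum_(i <- r) c i * inner01 (F i) h.
Proof.
elim: r => [|i r ih] bF bh.
  rewrite big_nil /inner01; under eq_Rintegral do rewrite big_nil mul0r.
  by rewrite Rintegral_cst ?mul0r.
have bi : bounded_mfun (F i) by apply: bF; rewrite mem_head.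
have br j : j \in r -> bounded_mfun (F j).
  by move=> jr; apply: bF; rewrite inE jr orbT.
rewrite big_cons -ih// -inner01Zl// -inner01Dl//; last 2 first.
- exact: bounded_mfunZ.
- by apply: bounded_mfun_sum => j jr; apply: bounded_mfunZ; exact: br.
by congr (inner01 _ h); apply/funext => x; rewrite big_cons.
Qed.

Lemma inner01_ge0 f : 0 <= inner01 f f.
Proof. by apply: Rintegral_ge0 => x _; rewrite -expr2 sqr_ge0. Qed.

Lemma sqnorm01E f : bounded_mfun f -> sqnorm01 f = (inner01 f f)%:E.
Proof.
move=> bf; rewrite /sqnorm01 /inner01 /Rintegral fineK; last first.
  apply: integrable_fin_num => //.
  by apply: bounded_mfun_integrable; exact: bounded_mfunM.
by apply: eq_integral => x _; rewrite expr2.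
Qed.

Lemma sqr_inner01_le f h : bounded_mfun f -> bounded_mfun h ->
  inner01 h h = 1 -> inner01 f h ^+ 2 <= inner01 f f.
Proof.
move=> bf bh h1; set c := inner01 f h.
have bc := bounded_mfunZ c bh.
have bfc := bounded_mfunB bf bc.
have := inner01_ge0 (fun x => f x - c * h x).
rewrite inner01Bl// (inner01C f) (inner01C (fun x => c * h x)) !inner01Bl//.
rewrite (inner01C f (fun x => c * h x)) !inner01Zl// (inner01C h f) -/c.
rewrite (inner01C h (fun x => c * h x)) inner01Zl// h1.
lra.
Qed.

Lemma inner01_lincomb_le (I : eqType) (r : seq I) (c : I -> R) (F : I -> R -> R)
    (v : R) :
  (forall i, i \in r -> bounded_mfun (F i)) ->
  (forall i, i \in r -> inner01 (F i) (F i) <= v) ->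
  inner01 (fun x => \sum_(i <- r) c i * F i x)
          (fun x => \sum_(i <- r) c i * F i x) <=
  (size r)%:R * (\sum_(i <- r) c i ^+ 2) * v.
Proof.
move=> bF Fv.
have bS : bounded_mfun (fun x => \sum_(i <- r) c i * F i x).
  by apply: bounded_mfun_sum => i ir; apply: bounded_mfunZ; exact: bF.
rewrite inner01_suml//.
have -> : (size r)%:R * (\sum_(i <- r) c i ^+ 2) * v =
    \sum_(i <- r) \sum_(j <- r) ((c i ^+ 2 + c j ^+ 2) / 2 * v).
  have E : \sum_(i <- r) \sum_(j <- r) (c i ^+ 2) =
           (size r)%:R * (\sum_(i <- r) c i ^+ 2).
    rewrite mulr_sumr; apply: eq_bigr => i _.
    by rewrite big_const_seq count_predT iter_addr_0 mulr_natl.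
  transitivity ((\sum_(i <- r) \sum_(j <- r) c i ^+ 2 +
                 \sum_(i <- r) \sum_(j <- r) c j ^+ 2) * (v / 2)).
    by rewrite [X in _ + X]exchange_big/= E; field.
  rewrite -big_split mulr_suml; apply: eq_bigr => i _ /=.
  by rewrite -big_split mulr_suml; apply: eq_bigr => j _ /=; field.
rewrite big_seq [leRHS]big_seq; apply: ler_sum => i ir.
rewrite (inner01C (F i)) inner01_suml//; last exact: bF.
rewrite mulr_sumr big_seq [leRHS]big_seq; apply: ler_sum => j jr.
have bi := bF _ ir; have bj := bF _ jr.
have bci := bounded_mfunZ (c i) bi; have bcj := bounded_mfunZ (c j) bj.
(* 2 c_i c_j <F_i, F_j> <= |c_i F_i|^2 + |c_j F_j|^2 *)
have := inner01_ge0 (fun x => c i * F i x - c j * F j x).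
rewrite inner01Bl//; last exact: bounded_mfunB.
rewrite !inner01Zl//; try exact: bounded_mfunB.
rewrite (inner01C (F i)) (inner01C (F j) (fun x => _ - _)) !inner01Bl//.
rewrite !inner01Zl// (inner01C (F i) (F j)).
have := Fv _ ir; have := Fv _ jr.
move: (inner01 (F i) (F i)) (inner01 (F j) (F j)) (inner01 (F j) (F i)).
move=> A B G Bv Av H.
have : 0 <= c i ^+ 2 * (v - A) by rewrite mulr_ge0 ?sqr_ge0 ?subr_ge0.
have : 0 <= c j ^+ 2 * (v - B) by rewrite mulr_ge0 ?sqr_ge0 ?subr_ge0.
nra.
Qed.

End InnerProduct.

Section HaarSteps.
Context {R : realType}.
Implicit Types (t u v : R) (b : bool) (j k : nat).

(* Both the closed and the open half-lines are needed, since haar_psi is built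
   from closed intervals overlapping at their common endpoint. *)
Definition step b t : R -> R := \1_([set` Interval (BSide b t) +oo%O]).

Lemma stepE b t x : step b t x = (if b then t <= x else t < x)%:R.
Proof. by rewrite /step indicE mem_setE in_itv/= andbT; case: b. Qed.

Lemma bounded_mfun_step b t : bounded_mfun (step b t).
Proof.
split; first by apply: measurable_indic; exact: measurable_itv.
exists 1 => x; rewrite stepE ger0_norm ?ler0n//.
by rewrite (_ : 1 = 1%:R)// ler_nat leq_b1.
Qed.

Lemma inner01_step b c u v : 0 <= u <= 1 -> 0 <= v <= 1 ->
  inner01 (step b u) (step c v) = 1 - Num.max u v.
Proof.
wlog uv : b c u v / u <= v.
  move=> H hu hv; have [uv|vu] := leP u v.
    by rewrite H// max_r.
  by rewrite inner01C H// ?(ltW vu)// max_r// ltW.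
move=> /andP[u0 u1] /andP[v0 v1]; rewrite max_r//.
have [e be] : exists e, forall x, 0 <= x <= 1 ->
    step b u x * step c v x = step e v x.
  move: uv; rewrite le_eqVlt => /orP[/eqP <-|uv].
    exists (b && c) => x _; rewrite !stepE -natrM mulnb.
    by case: b; case: c => /=; rewrite ?andbb//; case: (ltgtP u x).
  exists c => x _; rewrite !stepE -natrM mulnb; congr (_%:R); congr nat_of_bool.
  by case: b; case: c => /=; lra.
transitivity (\int[@lebesgue_measure R]_(x in `[0, 1]) step e v x).
  by apply: eq_Rintegral => x; rewrite inE/= in_itv/= => /be.
rewrite /Rintegral integral_indic//.
rewrite (_ : _ `&` _ = [set` Interval (BSide e v) (BRight 1)]); last first.
  apply/seteqP; split => x /=; rewrite !in_itv/=; case: e {be} => /=; lra.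
rewrite [X in fine X]lebesgue_measure_itv/= lte_fin; case: ltP => /= v1'; first by [].
by apply/eqP; rewrite eq_sym subr_eq0; apply/eqP/le_anti/andP.
Qed.

Definition dyad j k : R := k%:R / 2 ^+ j.

Definition mid j k : R := dyad j.+1 k.*2.+1.

(* The primitive of 2^(-j/2) psi_(j,k). *)
Definition tent j k t : R :=
  Num.max t (dyad j k) + Num.max t (dyad j k.+1) - 2 * Num.max t (mid j k).

Lemma dyadS j k : dyad j.+1 k.*2 = dyad j k.
Proof. by rewrite /dyad -muln2 natrM exprS; field; rewrite expf_neq0. Qed.

Lemma dyad_ge0 j k : 0 <= dyad j k.
Proof. by rewrite divr_ge0 ?ler0n ?exprn_ge0. Qed.

Lemma dyad_le j k l : (dyad j k <= dyad j l) = (k <= l)%N.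
Proof. by rewrite ler_pM2r ?ler_nat// invr_gt0 exprn_gt0. Qed.

Lemma dyad_lt j k l : (dyad j k < dyad j l) = (k < l)%N.
Proof. by rewrite ltNge dyad_le -ltnNge. Qed.

Lemma dyad_le1 j k : (dyad j k <= 1) = (k <= 2 ^ j)%N.
Proof. by rewrite ler_pdivrMr ?exprn_gt0// mul1r -natrX ler_nat. Qed.

Lemma dyad_succ j k : dyad j k.+1 = dyad j k + 2^-1 ^+ j.
Proof. by rewrite /dyad -natr1 mulrDl mul1r exprVn. Qed.

Lemma midE j k : mid j k = (dyad j k + dyad j k.+1) / 2.
Proof.
rewrite /mid dyad_succ dyadS dyad_succ exprS; lra.
Qed.

Lemma tent_out j k t : (t <= dyad j k) || (dyad j k.+1 <= t) -> tent j k t = 0.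
Proof.
have : dyad j k <= dyad j k.+1 by rewrite dyad_le.
rewrite /tent midE; move: (dyad j k) (dyad j k.+1) => l r lr /orP[tl|rt].
  by rewrite !max_r; lra.
by rewrite !max_l; lra.
Qed.

Lemma tent_left j k t : dyad j k <= t <= mid j k -> tent j k t = t - dyad j k.
Proof.
have : dyad j k <= dyad j k.+1 by rewrite dyad_le.
rewrite /tent midE; move: (dyad j k) (dyad j k.+1) => l r lr /andP[lt tm].
by rewrite (max_l lt) !max_r; lra.
Qed.

Lemma tent_right j k t : mid j k <= t <= dyad j k.+1 ->
  tent j k t = dyad j k.+1 - t.
Proof.
have : dyad j k <= dyad j k.+1 by rewrite dyad_le.
rewrite /tent midE; move: (dyad j k) (dyad j k.+1) => l r lr /andP[mt tr].
by rewrite (max_r tr) !max_l; lra.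
Qed.

Lemma haar_psi_jkE j k : haar_psi_jk j k = fun x => Num.sqrt (2 ^+ j) *
  (step true (dyad j k) x - step false (mid j k) x -
   step true (mid j k) x + step false (dyad j k.+1) x).
Proof.
apply/funext => x; rewrite /haar_psi_jk /haar_psi; congr (_ * _).
set y := 2 ^+ j * x - k%:R.
have p : 0 < (2 : R) ^+ j by rewrite exprn_gt0.
have xE : x = (y + k%:R) / 2 ^+ j.
  by rewrite /y; field; rewrite expf_neq0.
have A1 : (dyad j k <= x) = (0 <= y).
  by rewrite xE /dyad ler_pM2r ?invr_gt0// lerDr.
have mE : mid j k = (2^-1 + k%:R) / 2 ^+ j.
  by rewrite midE dyad_succ /dyad exprVn; field; rewrite expf_neq0.
have A2 : (mid j k < x) = (2^-1 < y).
  by rewrite mE xE ltr_pM2r ?invr_gt0// ltrD2r.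
have A3 : (mid j k <= x) = (2^-1 <= y).
  by rewrite mE xE ler_pM2r ?invr_gt0// lerD2r.
have A4 : (dyad j k.+1 < x) = (1 < y).
  by rewrite xE /dyad ltr_pM2r ?invr_gt0// -natr1 addrC ltrD2r.
rewrite !stepE A1 A2 A3 A4 !indicE !mem_setE !in_itv/=.
case: (leP 0 y) => y0; case: (leP y 2^-1) => y1; case: (leP 2^-1 y) => y2;
  case: (leP y 1) => y3 /=; rewrite ?mulr1n ?mulr0n; lra.
Qed.

Lemma haar_phiE : haar_phi = fun x : R => step true 0 x - step false 1 x.
Proof.
apply/funext => x; rewrite /haar_phi !stepE indicE mem_setE in_itv/=.
case: (leP 0 x) => y0; case: (leP x 1) => y1 /=; rewrite ?mulr1n ?mulr0n; lra.
Qed.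

Lemma bounded_mfun_haar n : bounded_mfun (@haar R n).
Proof.
case: n => [|n]; rewrite /haar.
  by rewrite haar_phiE; apply: bounded_mfunB; exact: bounded_mfun_step.
rewrite haar_psi_jkE; apply: bounded_mfunZ; apply: bounded_mfunD.
  by do 2 (apply: bounded_mfunB; last exact: bounded_mfun_step);
    exact: bounded_mfun_step.
exact: bounded_mfun_step.
Qed.

Lemma inner01_psi j k (g : R -> R) : bounded_mfun g ->
  inner01 (haar_psi_jk j k) g = Num.sqrt (2 ^+ j) *
    (inner01 (step true (dyad j k)) g - inner01 (step false (mid j k)) g -
     inner01 (step true (mid j k)) g + inner01 (step false (dyad j k.+1)) g).
Proof.
move=> bg; have bs := bounded_mfun_step; rewrite haar_psi_jkE.
have b1 := bounded_mfunB (bs true (dyad j k)) (bs false (mid j k)).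
have b2 := bounded_mfunB b1 (bs true (mid j k)).
have b3 := bounded_mfunD b2 (bs false (dyad j k.+1)).
by rewrite inner01Zl// inner01Dl// !inner01Bl.
Qed.

Lemma dyad01 j k : (k <= 2 ^ j)%N -> 0 <= dyad j k <= 1.
Proof. by move=> kj; rewrite dyad_ge0 dyad_le1. Qed.

Lemma mid01 j k : (k < 2 ^ j)%N -> 0 <= mid j k <= 1.
Proof.
move=> kj; apply: dyad01; rewrite expnS; move: (2 ^ j)%N kj => N; lia.
Qed.

Lemma inner01_step_psi b j k t : 0 <= t <= 1 -> (k < 2 ^ j)%N ->
  inner01 (step b t) (haar_psi_jk j k) = - (Num.sqrt (2 ^+ j) * tent j k t).
Proof.
move=> t01 kj; have bs := bounded_mfun_step.
have k0 := dyad01 (ltnW kj); have k1 := dyad01 kj; have k2 := mid01 kj.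
rewrite inner01C inner01_psi// !inner01_step//.
rewrite !(maxC _ t) /tent; ring.
Qed.

Lemma inner01_step_phi b t : 0 <= t <= 1 ->
  inner01 (step b t) haar_phi = 1 - t.
Proof.
move=> t01; have bs := bounded_mfun_step.
rewrite inner01C haar_phiE inner01Bl// !inner01_step ?lexx ?ler01//.
by move/andP: t01 => [t0 t1]; rewrite max_r// max_l//; lra.
Qed.

End HaarSteps.

Section HaarOrthonormal.
Context {R : realType}.
Implicit Types (t : R) (j k : nat).
Local Notation dyad := (@dyad R).
Local Notation mid := (@mid R).
Local Notation tent := (@tent R).

Lemma dyadM e j k : dyad (j + e) (k * 2 ^ e) = dyad j k.
Proof.
by rewrite /dyad natrM natrX exprD; field; rewrite !expf_neq0.
Qed.

Lemma dyad_coarse e j k (i := (k %/ 2 ^ e)%N) :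
  dyad j i <= dyad (j + e) k /\ dyad (j + e) k.+1 <= dyad j i.+1.
Proof.
rewrite -(dyadM e j i) -(dyadM e j i.+1) !dyad_le leq_divM; split => //.
by rewrite ltn_ceil// expn_gt0.
Qed.

Lemma mid_itv j k : dyad j k <= mid j k <= dyad j k.+1.
Proof.
have : dyad j k <= dyad j k.+1 by rewrite dyad_le.
by rewrite midE; lra.
Qed.

Lemma tent_affine j k j' k' : (j < j')%N ->
  tent j k (dyad j' k') + tent j k (dyad j' k'.+1) = 2 * tent j k (mid j' k').
Proof.
move=> jj'; rewrite -(subnKC jj'); set e := (j' - j.+1)%N.
have [] := dyad_coarse e j.+1 k'; set i := (k' %/ 2 ^ e)%N.
have /andP[] := mid_itv (j.+1 + e) k'.
have := @midE R (j.+1 + e) k'.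
move: (dyad (j.+1 + e) k') (dyad (j.+1 + e) k'.+1) (mid (j.+1 + e) k').
move=> l r m mE lm mr li ri.
have [ik|ki] := ltnP i k.*2.
  have : dyad j.+1 i.+1 <= dyad j k by rewrite -(@dyadS R j k) dyad_le.
  by move=> h; rewrite !tent_out ?mulr0 ?addr0//; apply/orP; left; lra.
have [ik|{}ki] := ltnP i k.*2.+1.
  have ie : i = k.*2 by lia.
  move: li ri; rewrite ie dyadS -/(mid _ _) => li ri.
  by rewrite !tent_left; lra.
have [ik|{}ki] := ltnP i k.*2.+2.
  have ie : i = k.*2.+1 by lia.
  move: li ri; rewrite ie -doubleS dyadS -/(mid _ _) => li ri.
  by rewrite !tent_right; lra.
have : dyad j k.+1 <= dyad j.+1 i by rewrite -(@dyadS R j k.+1) dyad_le doubleS.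
by move=> h; rewrite !tent_out ?mulr0 ?addr0//; apply/orP; right; lra.
Qed.

Lemma inner01_psi_psi j k j' k' : (k < 2 ^ j)%N -> (k' < 2 ^ j')%N ->
  inner01 (haar_psi_jk j' k') (haar_psi_jk j k) =
  - (Num.sqrt (2 ^+ j') * Num.sqrt (2 ^+ j) *
     (tent j k (dyad j' k') + tent j k (dyad j' k'.+1) -
      2 * tent j k (mid j' k'))).
Proof.
move=> kj kj'; rewrite inner01_psi; last first.
  by rewrite -haar_Ind//; exact: bounded_mfun_haar.
by rewrite !inner01_step_psi ?mid01 ?dyad01 ?(ltnW kj')//; ring.
Qed.

Lemma psi_orthonormal j k j' k' : (k < 2 ^ j)%N -> (k' < 2 ^ j')%N ->
  inner01 (haar_psi_jk j' k') (haar_psi_jk j k) =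
  ((j == j') && (k == k'))%:R :> R.
Proof.
wlog : j k j' k' / (j <= j')%N.
  move=> H kj kj'; have [jj|jj] := leqP j j'; first exact: H.
  by rewrite inner01C H// 1?ltnW// (eq_sym j) (eq_sym k).
rewrite leq_eqVlt => /orP[/eqP <-{j'}|jj'] kj kj'; last first.
  rewrite inner01_psi_psi// tent_affine// subrr mulr0 oppr0.
  by rewrite (ltn_eqF jj').
rewrite eqxx/= inner01_psi_psi//; have /andP[lm mr] := mid_itv j k'.
have [<-{k' kj' lm mr}|] := eqVneq k k'.
  rewrite (tent_out (t := dyad j k)) ?lexx// (tent_out (t := dyad j k.+1)) ?lexx ?orbT//.
  rewrite tent_left ?lexx ?andbT; last by case/andP: (mid_itv j k).
  rewrite -expr2 sqr_sqrtr ?exprn_ge0// midE dyad_succ exprVn.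
  by rewrite mulr1n; field; rewrite expf_neq0.
rewrite neq_ltn => /orP[kk|kk].
  have : dyad j k.+1 <= dyad j k' by rewrite dyad_le.
  move=> h; rewrite !tent_out ?mulr0 ?addr0 ?subr0 ?mulr0 ?oppr0//;
    by apply/orP; right; lra.
have : dyad j k'.+1 <= dyad j k by rewrite dyad_le.
move=> h; rewrite !tent_out ?mulr0 ?addr0 ?subr0 ?mulr0 ?oppr0//;
  by apply/orP; left; lra.
Qed.

Lemma haar_index n : (0 < n)%N -> exists j k, (k < 2 ^ j)%N /\ n = (2 ^ j + k)%N.
Proof.
move=> n0; exists (trunc_log 2 n), (n - 2 ^ trunc_log 2 n)%N.
have /andP[h1 h2] := trunc_log_bounds (isT : 1 < 2)%N n0.
by rewrite subnKC//; split => //; move: h2; rewrite expnS; lia.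
Qed.

Lemma inner01_psi_phi j k : (k < 2 ^ j)%N ->
  inner01 (haar_psi_jk j k) (@haar_phi R) = 0.
Proof.
move=> kj; rewrite inner01_psi; last exact: (bounded_mfun_haar 0).
rewrite !inner01_step_phi ?mid01 ?dyad01 ?(ltnW kj)//.
by rewrite midE dyad_succ; apply/eqP; rewrite mulf_eq0; apply/orP; right; apply/eqP; lra.
Qed.

Lemma haar_orthonormal m n : inner01 (@haar R m) (haar n) = (m == n)%:R.
Proof.
case: m n => [|m] [|n].
- rewrite /= haar_phiE; have bs := @bounded_mfun_step R.
  rewrite -haar_phiE {1}haar_phiE inner01Bl//; last exact: (bounded_mfun_haar 0).
  by rewrite !inner01_step_phi ?lexx ?ler01// subr0 subrr subr0.
- have [j [k [kj ->]]] := haar_index (ltn0Sn n).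
  rewrite haar_Ind// inner01C inner01_psi_phi//.
  by rewrite eq_sym addn_eq0 expn_eq0.
- have [j [k [kj ->]]] := haar_index (ltn0Sn m).
  by rewrite haar_Ind// inner01_psi_phi// addn_eq0 expn_eq0.
have [j [k [kj ->]]] := haar_index (ltn0Sn m).
have [j' [k' [kj' ->]]] := haar_index (ltn0Sn n).
rewrite !haar_Ind// psi_orthonormal//; congr (_%:R); congr nat_of_bool.
apply/andP/eqP => [[/eqP -> /eqP ->]//|e].
have jj : j' = j.
  apply/eqP; rewrite eqn_leq; apply/andP; split;
    rewrite -ltnS -(@ltn_exp2l 2)// expnS; lia.
by move: e; rewrite jj => /addnI ->; rewrite !eqxx.
Qed.

Lemma haar_coef_step t j k : 0 <= t <= 1 -> (k < 2 ^ j)%N ->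
  haar_coef (step true t) (2 ^ j + k) = - (Num.sqrt (2 ^+ j) * tent j k t).
Proof. by move=> t01 kj; rewrite /haar_coef haar_Ind// inner01_step_psi. Qed.

Lemma big_dyadic_split (V : nmodType) (F : nat -> V) j :
  \sum_(0 <= n < 2 ^ j.+1) F n =
  \sum_(0 <= n < 2 ^ j) F n + \sum_(k < 2 ^ j) F (2 ^ j + k)%N.
Proof.
rewrite (big_cat_nat (n := (2 ^ j)%N))//=; last by rewrite leq_exp2l.
congr (_ + _); rewrite -{1}(add0n (2 ^ j)%N) big_addn expnS mul2n -addnn addnK.
by rewrite big_mkord; apply: eq_bigr => i _; rewrite addnC.
Qed.

Lemma step_energy j t : 0 <= t <= 1 ->
  exists k, [/\ (k < 2 ^ j)%N, dyad j k <= t <= dyad j k.+1 &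
    \sum_(0 <= n < 2 ^ j) haar_coef (step true t) n ^+ 2 =
    1 - t - 2 ^+ j * ((t - dyad j k) * (dyad j k.+1 - t))].
Proof.
move=> t01; elim: j => [|j [k [kj kt E]]].
  exists 0%N; split => //; first by rewrite /dyad expr0 mul0r divr1.
  rewrite big_nat1 /haar_coef inner01_step_phi//.
  by rewrite /dyad expr0 !divr1; ring.
have S : \sum_(k0 < 2 ^ j) haar_coef (step true t) (2 ^ j + k0) ^+ 2 =
    2 ^+ j * tent j k t ^+ 2.
  rewrite (bigD1 (Ordinal kj))//= big1 ?addr0.
    by rewrite haar_coef_step// sqrrN exprMn sqr_sqrtr// exprn_ge0.
  move=> i; rewrite -val_eqE/= neq_ltn => ik.
  rewrite haar_coef_step// tent_out ?mulr0 ?oppr0 ?expr0n//.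
  move: kt => /andP[k1 k2]; case/orP: ik => ik; apply/orP; [right|left].
    by apply: le_trans k1; rewrite dyad_le.
  by apply: (le_trans k2); rewrite dyad_le.
have [tm|mt] := leP t (mid j k).
  exists k.*2; split; first by rewrite expnS; lia.
    by rewrite dyadS -/(mid _ _) tm andbT; case/andP: kt.
  rewrite big_dyadic_split E S tent_left ?tm ?andbT; last by case/andP: kt.
  rewrite dyadS -/(mid _ _) midE (exprS 2 j).
  by move: (dyad j k) (dyad j k.+1) (2 ^+ j) => l r N; field.
exists k.*2.+1; split; first by rewrite expnS; lia.
  by rewrite -doubleS dyadS -/(mid _ _) (ltW mt); case/andP: kt.
rewrite big_dyadic_split E S tent_right ?(ltW mt); last by case/andP: kt.
rewrite -doubleS dyadS -/(mid _ _) midE (exprS 2 j).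
by move: (dyad j k) (dyad j k.+1) (2 ^+ j) => l r N; field.
Qed.

End HaarOrthonormal.

(** * Greedy approximation of step functions *)

Section Greedy.
Context {R : realType}.
Implicit Types (f g : R -> R) (M n : nat).

Lemma haar_coef_eq f g : {in `[0, 1]%classic, f =1 g} ->
  @haar_coef R f = haar_coef g.
Proof.
move=> fg; apply/funext => n; rewrite /haar_coef /inner01.
by apply: eq_Rintegral => x x01; rewrite fg.
Qed.

Lemma greedy_eq M f g : {in `[0, 1]%classic, f =1 g} -> greedy M f = greedy M g.
Proof.
by move=> fg; rewrite /greedy /greedy_indices (haar_coef_eq fg).
Qed.

Lemma sqnorm01_greedy_eq M f g : {in `[0, 1]%classic, f =1 g} ->
  sqnorm01 (fun x => f x - greedy M f x) = sqnorm01 (fun x => g x - greedy M g x).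
Proof.
move=> fg; rewrite (greedy_eq M fg) /sqnorm01.
by apply: eq_integral => x x01; rewrite fg.
Qed.

Definition nnz f n : nat := \sum_(0 <= m < n) (haar_coef f m != 0%R).

Lemma nnzS f n : nnz f n.+1 = (nnz f n + (haar_coef f n != 0%R))%N.
Proof. by rewrite /nnz big_nat_recr. Qed.

Lemma nnz_mono f m n : (m <= n)%N -> (nnz f m <= nnz f n)%N.
Proof.
elim: n => [|n ih]; first by rewrite leqn0 => /eqP ->.
rewrite leq_eqVlt => /orP[/eqP -> //|]; rewrite ltnS => /ih h.
by rewrite nnzS (leq_trans h)// leq_addr.
Qed.

Lemma greedy_indicesP M f n :
  greedy_indices M f n <-> haar_coef f n != 0 /\ (nnz f n < M)%N.
Proof. by rewrite /greedy_indices /nnz big_mkord. Qed.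

Lemma finite_greedy_indices M f : finite_set (greedy_indices M f).
Proof.
pose h k := get [set n | greedy_indices M f n /\ nnz f n = k].
apply: (@sub_finite_set _ _ (h @` `I_M)); last exact/finite_image/finite_II.
move=> n Gn; have /greedy_indicesP[cn nM] := Gn; exists (nnz f n) => //.
have [/greedy_indicesP[hn0 _] hE] :
  [set m | greedy_indices M f m /\ nnz f m = nnz f n] (h (nnz f n)).
  by apply: (@getPex _ [set m | greedy_indices M f m /\ nnz f m = nnz f n]); exists n.
case: (ltngtP (h (nnz f n)) n) => // lt; have := nnz_mono f lt.
  by rewrite nnzS hE hn0 addn1 ltnn.
by rewrite nnzS hE cn addn1 ltnn.
Qed.

Lemma greedy_seq M f : exists s : seq nat,
  [/\ uniq s, forall n, n \in s <-> greedy_indices M f n &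
      greedy M f = fun x => \sum_(n <- s) haar_coef f n * haar n x].
Proof.
have /finite_seqP[s sE] := finite_greedy_indices M f.
exists (undup s); split; first exact: undup_uniq.
- by move=> n; rewrite mem_undup sE.
- apply/funext => x; rewrite /greedy.
  have -> : greedy_indices M f = [set` undup s].
    by rewrite sE; apply/seteqP; split => n /=; rewrite mem_undup.
  by rewrite -fsbig_seq ?undup_uniq.
Qed.

Definition haar_sum (s : seq nat) f (x : R) : R :=
  \sum_(n <- s) haar_coef f n * haar n x.

Lemma bounded_mfun_haar_sum s f : bounded_mfun (haar_sum s f).
Proof.
by apply: bounded_mfun_sum => n _; apply: bounded_mfunZ; exact: bounded_mfun_haar.
Qed.

Lemma haar_coef_haar_sum s f n : uniq s ->
  haar_coef (haar_sum s f) n = if n \in s then haar_coef f n else 0.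
Proof.
have bh := @bounded_mfun_haar R.
move=> us; rewrite {1}/haar_coef inner01_suml//.
under eq_bigr do rewrite haar_orthonormal.
have [ns|ns] := boolP (n \in s).
  rewrite (bigD1_seq n)//= eqxx mulr1 big1 ?addr0// => m mn.
  by rewrite (negbTE mn) mulr0.
rewrite big_seq big1// => m ms; have [mn|_] := eqVneq m n; last by rewrite mulr0.
by rewrite -mn ms in ns.
Qed.

Lemma inner01_residual s f : bounded_mfun f -> uniq s ->
  inner01 (fun x => f x - haar_sum s f x) (fun x => f x - haar_sum s f x) =
  inner01 f f - \sum_(n <- s) haar_coef f n ^+ 2.
Proof.
move=> bf us; have bh := @bounded_mfun_haar R.
have bF := bounded_mfun_haar_sum s f.
rewrite inner01Bl//; last exact: bounded_mfunB.
rewrite (inner01C f) (inner01C (haar_sum s f)) !inner01Bl//.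
rewrite (inner01C f (haar_sum s f)).
have E g : bounded_mfun g ->
    inner01 (haar_sum s f) g = \sum_(n <- s) haar_coef f n * haar_coef g n.
  by move=> bg; rewrite inner01_suml//; apply: eq_bigr => n _; rewrite inner01C.
rewrite !E//.
have -> : \sum_(n <- s) haar_coef f n * haar_coef (haar_sum s f) n =
    \sum_(n <- s) haar_coef f n ^+ 2.
  by rewrite !big_seq; apply: eq_bigr => n ns; rewrite haar_coef_haar_sum// ns expr2.
by under eq_bigr do rewrite -expr2; ring.
Qed.

Lemma ler_sum_subset (I : eqType) (s s' : seq I) (F : I -> R) :
  uniq s -> uniq s' -> {subset s' <= s} -> (forall i, 0 <= F i) ->
  \sum_(i <- s') F i <= \sum_(i <- s) F i.
Proof.
move=> us us' ss' F0; rewrite [leRHS](bigID (mem s'))/= -[X in _ <= X + _]big_filter.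
have pe : perm_eq [seq i <- s | i \in s'] s'.
  apply: uniq_perm => //; first exact: filter_uniq.
  by move=> i; rewrite mem_filter andb_idr// => /ss'.
by rewrite (perm_big _ pe)/= lerDl sumr_ge0.
Qed.

Lemma greedy_error_le M f N : bounded_mfun f -> (nnz f N <= M)%N ->
  (sqnorm01 (fun x => f x - greedy M f x)%R <=
   (inner01 (fun x => f x - haar_sum (iota 0 N) f x)
            (fun x => f x - haar_sum (iota 0 N) f x))%:E)%E.
Proof.
move=> bf NM; have [s [us sG ->]] := greedy_seq M f.
rewrite -/(haar_sum s f) sqnorm01E; last first.
  by apply: bounded_mfunB => //; exact: bounded_mfun_haar_sum.
rewrite lee_fin !inner01_residual ?iota_uniq// lerD2l lerN2.
rewrite (bigID (fun n => haar_coef f n == 0))/= [X in X + _]big1 ?add0r; last first.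
  by move=> n /eqP ->; rewrite expr0n.
rewrite -big_filter; apply: ler_sum_subset => //.
- by rewrite filter_uniq// iota_uniq.
- move=> n; rewrite mem_filter mem_iota/= add0n => /andP[cn nN].
  apply/sG/greedy_indicesP; split => //.
  by apply: leq_trans NM; apply: leq_trans (nnz_mono f nN); rewrite nnzS cn addn1.
- by move=> n; exact: sqr_ge0.
Qed.

Lemma greedy_error_ge M f n : bounded_mfun f -> (M <= nnz f n)%N ->
  ((haar_coef f n ^+ 2)%:E <= sqnorm01 (fun x => f x - greedy M f x)%R)%E.
Proof.
move=> bf Mn; have [s [us sG ->]] := greedy_seq M f.
have bF := bounded_mfun_haar_sum s f; have bh := @bounded_mfun_haar R.
rewrite -/(haar_sum s f) sqnorm01E; last exact: bounded_mfunB.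
have ns : n \notin s.
  by apply/negP => /sG/greedy_indicesP[_]; rewrite ltnNge Mn.
have -> : haar_coef f n = inner01 (fun x => f x - haar_sum s f x) (haar n).
  rewrite inner01Bl// -/(haar_coef f n) -/(haar_coef (haar_sum s f) n).
  by rewrite haar_coef_haar_sum// (negbTE ns) subr0.
by rewrite lee_fin sqr_inner01_le ?haar_orthonormal ?eqxx//; exact: bounded_mfunB.
Qed.

End Greedy.

Section JumpPath.
Context {R : realType}.
Variables (r : seq nat) (a t : nat -> R).
Hypothesis t01 : forall i, i \in r -> 0 < t i <= 1.
Local Notation dyad := (@dyad R).
Local Notation mid := (@mid R).
Local Notation tent := (@tent R).

Definition jump_path (x : R) : R := \sum_(i <- r) a i * step true (t i) x.

Let t01w i : i \in r -> 0 <= t i <= 1.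
Proof. by move=> /t01/andP[/ltW -> ->]. Qed.

Lemma bounded_mfun_jump_path : bounded_mfun jump_path.
Proof.
by apply: bounded_mfun_sum => i _; apply: bounded_mfunZ; exact: bounded_mfun_step.
Qed.

Lemma haar_coef_jump_path n :
  haar_coef jump_path n = \sum_(i <- r) a i * haar_coef (step true (t i)) n.
Proof.
rewrite /haar_coef inner01_suml//; last exact: bounded_mfun_haar.
by move=> i _; exact: bounded_mfun_step.
Qed.

Lemma haar_coef_step_neq0 j k (u : R) : 0 <= u <= 1 -> (k < 2 ^ j)%N ->
  haar_coef (step true u) (2 ^ j + k) != 0 -> dyad j k < u < dyad j k.+1.
Proof.
move=> u01 kj; rewrite haar_coef_step// oppr_eq0; apply: contraR.
rewrite negb_and -!leNgt => h.
by rewrite tent_out ?mulr0.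
Qed.

Lemma nnz_scale_jump_path j :
  (\sum_(k < 2 ^ j) (haar_coef jump_path (2 ^ j + k) != 0%R) <= size r)%N.
Proof.
apply: (@leq_trans (\sum_(k < 2 ^ j) \sum_(i <- r) (dyad j k < t i < dyad j k.+1)%R)).
  apply: leq_sum => k _.
  have [//|] := eqVneq (haar_coef jump_path (2 ^ j + k)) 0; apply: contraNleq.
  rewrite ltnS leqn0 sum_nat_seq_eq0 => /allP h.
  rewrite haar_coef_jump_path big_seq big1// => i ir.
  apply/eqP; rewrite mulf_eq0; apply/orP; right.
  have := h _ ir; rewrite /= eqb0; apply: contraNT.
  by apply: haar_coef_step_neq0 => //; exact: t01w.
rewrite exchange_big/= -sum1_size big_seq [leqRHS]big_seq; apply: leq_sum => i ir.
case: (pickP (fun k : 'I_(2 ^ j) => dyad j k < t i < dyad j k.+1)) => [k hk|h].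
  rewrite (bigD1 k)//= hk big1// => l lk.
  apply/eqP; rewrite eqb0; apply/negP => /andP[l1 l2].
  move: hk => /andP[k1 k2]; move: lk; rewrite -val_eqE/= eqn_leq.
  have := lt_trans l1 k2; have := lt_trans k1 l2.
  by rewrite !dyad_lt !ltnS => -> ->.
by rewrite big1// => k _; rewrite h.
Qed.

Lemma nnz_jump_path J : (nnz jump_path (2 ^ J) <= 1 + J * size r)%N.
Proof.
elim: J => [|J ih]; first by rewrite /nnz big_nat1 mul0n addn0 leq_b1.
rewrite /nnz big_dyadic_split mulSnr addnA leq_add//.
exact: nnz_scale_jump_path.
Qed.

Lemma greedy_error_jump_path_le M J : (1 + J * size r <= M)%N ->
  (sqnorm01 (fun x => jump_path x - greedy M jump_path x)%R <=
   ((size r)%:R * (\sum_(i <- r) a i ^+ 2) / 2 ^+ J)%:E)%E.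
Proof.
move=> JM; have bs := @bounded_mfun_step R; have bF := @bounded_mfun_haar_sum R.
apply: le_trans (greedy_error_le bounded_mfun_jump_path
  (leq_trans (nnz_jump_path J) JM)) _.
rewrite lee_fin; set s := iota _ _.
have E : (fun x => jump_path x - haar_sum s jump_path x) =
   fun x => \sum_(i <- r) a i * (step true (t i) x - haar_sum s (step true (t i)) x).
  apply/funext => x; rewrite /haar_sum /jump_path.
  under [in RHS]eq_bigr do rewrite mulrBr.
  rewrite big_split/=; congr (_ + _); rewrite sumrN; congr (- _).
  under eq_bigr do rewrite haar_coef_jump_path mulr_suml.
  rewrite exchange_big/=; apply: eq_bigr => i _.
  by rewrite mulr_sumr; apply: eq_bigr => n _; rewrite mulrA.
rewrite E; apply: inner01_lincomb_le => i ir; first exact: bounded_mfunB.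
rewrite inner01_residual ?iota_uniq//.
rewrite inner01_step ?t01w// maxxx.
have [k [_ /andP[kt tk] S]] := step_energy J (t01w ir).
move: S; rewrite /index_iota subn0 -/s => ->; rewrite dyad_succ.
move: kt tk; rewrite dyad_succ; move: (dyad J k) (t i) => l u.
have N0 : 0 < (2 : R) ^+ J by rewrite exprn_gt0.
rewrite exprVn => lu ul.
rewrite opprB addrCA subrr addr0 -[leRHS]mul1r -ler_pdivrMr ?invr_gt0//.
rewrite invrK.
have Nh : (2 ^+ J)^-1 * 2 ^+ J = 1 :> R by rewrite mulVf// gt_eqF.
move: (2 ^+ J) N0 ((2 ^+ J)^-1) ul Nh => N N0 h ul Nh.
rewrite [leLHS](_ : _ = ((u - l) * N) * ((l + h - u) * N)); last by ring.
by rewrite mulr_ile1 ?mulr_ge0 ?(ltW N0) -?Nh ?ler_pM2r//; lra.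
Qed.

Lemma tent_ge j k (u e : R) : 0 <= e ->
  dyad j k + e <= u <= dyad j k.+1 - e -> e <= tent j k u.
Proof.
move=> e0 ku; have [um|mu] := leP u (mid j k).
  by rewrite tent_left; lra.
by rewrite tent_right; lra.
Qed.

Lemma haar_coef_step_interior j k (u : R) : 0 <= u <= 1 -> (k < 2 ^ j)%N ->
  dyad j k < u < dyad j k.+1 -> haar_coef (step true u) (2 ^ j + k) != 0.
Proof.
move=> u01 kj /andP[ku uk]; rewrite haar_coef_step// oppr_eq0.
have e0 : 0 < Num.min (u - dyad j k) (dyad j k.+1 - u).
  by rewrite lt_min !subr_gt0 ku uk.
rewrite mulf_neq0// gt_eqF ?sqrtr_gt0 ?exprn_gt0//.
apply: (lt_le_trans e0); apply: tent_ge; first exact: ltW.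
set e := Num.min _ _.
have e1 : e <= u - dyad j k by rewrite ge_min lexx.
have e2 : e <= dyad j k.+1 - u by rewrite ge_min lexx orbT.
lra.
Qed.

Section Separated.
Variable q : nat.
Hypothesis ur : uniq r.
Hypothesis a_neq0 : forall i, i \in r -> a i != 0.
Hypothesis t_ndyad : forall i, i \in r -> forall j k, t i != dyad j k.
Hypothesis sep : forall m, (m < 2 ^ q)%N ->
  exists2 i, i \in r /\ dyad q m < t i <= dyad q m.+1 &
    forall i', i' \in r -> dyad q m < t i' <= dyad q m.+1 -> i' = i.

Lemma haar_coef_jump_path_single e i k : i \in r -> (k < 2 ^ (q + e))%N ->
  dyad (q + e) k < t i < dyad (q + e) k.+1 ->
  haar_coef jump_path (2 ^ (q + e) + k) =
  a i * haar_coef (step true (t i)) (2 ^ (q + e) + k).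
Proof.
move=> ir kj /andP[ki ik]; rewrite haar_coef_jump_path.
rewrite (bigD1_seq i)//= big_seq_cond big1 ?addr0// => l /andP[lr li].
have [le1 le2] := @dyad_coarse R e q k.
set m := (k %/ 2 ^ e)%N in le1 le2.
have mq : (m < 2 ^ q)%N by rewrite ltn_divLR ?expn_gt0// -expnD.
have [i0 [i0r _] u] := sep mq.
have ii0 : i = i0 by apply: u => //; rewrite (le_lt_trans le1 ki) (le_trans (ltW ik)).
apply/eqP; rewrite mulf_eq0; apply/orP; right.
apply: contraR li => /haar_coef_step_neq0 => /(_ (t01w lr) kj)/andP[kl lk].
rewrite ii0; apply/eqP; apply: u => //.
by rewrite (le_lt_trans le1 kl) (le_trans (ltW lk)).
Qed.

Lemma exists_haar_coef_neq0 e m : (m < 2 ^ q)%N ->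
  exists k : 'I_(2 ^ (q + e)),
    (k %/ 2 ^ e)%N = m /\ haar_coef jump_path (2 ^ (q + e) + k) != 0.
Proof.
move=> mq; have [i [ir /andP[mi im]] _] := sep mq.
have [k [kj /andP[ki ik] _]] := step_energy (q + e) (t01w ir).
have nd := t_ndyad ir.
have {}ki : dyad (q + e) k < t i by rewrite lt_neqAle eq_sym nd.
have {}ik : t i < dyad (q + e) k.+1 by rewrite lt_neqAle nd.
have [le1 le2] := @dyad_coarse R e q k.
exists (Ordinal kj); split => /=.
  apply/eqP; rewrite eqn_leq; apply/andP; split; rewrite -ltnS -(@dyad_lt R q).
    exact: lt_le_trans (le_lt_trans le1 ki) im.
  exact: lt_le_trans (lt_trans mi ik) le2.
rewrite (haar_coef_jump_path_single ir)// ?ki ?ik// mulf_neq0 ?a_neq0//.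
by apply: haar_coef_step_interior => //; rewrite ?ki ?ik// t01w.
Qed.

Lemma nnz_scale_ge e :
  (2 ^ q <= \sum_(k < 2 ^ (q + e)) (haar_coef jump_path (2 ^ (q + e) + k) != 0%R))%N.
Proof.
have p k : (k < 2 ^ (q + e))%N -> (k %/ 2 ^ e < 2 ^ q)%N.
  by move=> kj; rewrite ltn_divLR ?expn_gt0// -expnD.
rewrite (partition_big (fun k : 'I__ => Ordinal (p _ (ltn_ord k))) xpredT)//=.
rewrite -[leqLHS]card_ord -sum1_card; apply: leq_sum => m _.
have [k [km ck]] := exists_haar_coef_neq0 e (ltn_ord m).
by rewrite (bigD1 k) ?ck//= -val_eqE/= km.
Qed.

Lemma nnz_jump_path_ge L : (L * 2 ^ q <= nnz jump_path (2 ^ (q + L)))%N.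
Proof.
elim: L => [|L ih]; first by rewrite mul0n.
by rewrite addnS /nnz big_dyadic_split mulSnr leq_add// nnz_scale_ge.
Qed.

Lemma greedy_error_jump_path_ge M L i k : (M <= L * 2 ^ q)%N -> i \in r ->
  (k < 2 ^ (q + L))%N ->
  dyad (q + L) k + 2^-1 ^+ (q + L) / 4 <= t i <=
    dyad (q + L) k.+1 - 2^-1 ^+ (q + L) / 4 ->
  ((a i ^+ 2 / (16 * 2 ^+ (q + L)))%:E <=
   sqnorm01 (fun x => jump_path x - greedy M jump_path x)%R)%E.
Proof.
move=> ML ir kj ki.
have e0 : 0 < 2^-1 ^+ (q + L) / 4 :> R by rewrite divr_gt0 ?exprn_gt0.
have tg := tent_ge (ltW e0) ki.
apply: le_trans (greedy_error_ge (n := (2 ^ (q + L) + k)%N) bounded_mfun_jump_path _).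
  rewrite lee_fin (haar_coef_jump_path_single ir)//; last by lra.
  rewrite haar_coef_step ?t01w// exprMn sqrrN exprMn sqr_sqrtr ?exprn_ge0//.
  apply: ler_wpM2l; first exact: sqr_ge0.
  move: tg e0; rewrite exprVn; have N0 : 0 < (2 : R) ^+ (q + L) by rewrite exprn_gt0.
  move: (2 ^+ (q + L)) N0 (tent _ _ _) => N N0 u tg e0.
  have -> : (16 * N)^-1 = N * (N^-1 / 4) ^+ 2 by field; rewrite gt_eqF.
  by rewrite ler_wpM2l ?(ltW N0)// lerXn2r ?nnegrE ?(ltW e0)// (le_trans (ltW e0)).
apply: (leq_trans ML); apply: leq_trans (nnz_jump_path_ge L) _.
by apply: nnz_mono; rewrite leq_addr.
Qed.

End Separated.

End JumpPath.

(** * Marked point processes *)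

Section CountPoints.
Local Open Scope ereal_scope.
Context {d : measure_display} {T : measurableType d} {R : realType}.
Implicit Types (tau : nat -> T -> R) (A : set R) (w : T).

Lemma count_pointsE tau A w :
  count_points tau A w = \sum_(k <oo) (\1_A (tau k w))%:E.
Proof. by rewrite /count_points counting_dirac. Qed.

Lemma measurable_count_points tau A : measurable A ->
  (forall k, measurable_fun setT (tau k)) ->
  measurable_fun setT (count_points tau A).
Proof.
move=> mA mtau; rewrite (_ : count_points tau A =
    fun w => \sum_(0 <= k <oo | k \in xpredT) (\1_A (tau k w))%:E).
  apply: ge0_emeasurable_sum => [k w _ _|k _]; first by rewrite lee_fin.
  by apply/measurable_EFinP; apply: measurableT_comp (mtau k); exact: measurable_indic.
by apply/funext => w; rewrite count_pointsE.
Qed.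

Lemma nneseries_fin_support (r : seq nat) (f : nat -> R) : uniq r ->
  (forall k, (0 <= f k)%R) -> (forall k, k \notin r -> f k = 0%R) ->
  \sum_(k <oo) (f k)%:E = (\sum_(k <- r) f k)%:E.
Proof.
move=> ur f0 fr; rewrite nneseries_esumT; last by move=> k; rewrite lee_fin.
have -> : \esum_(k in setT) (f k)%:E = \esum_(k in [set` r]) (f k)%:E.
  rewrite [RHS]esum_mkcond; apply: eq_esum => k _.
  by case: ifPn => //; rewrite notin_setE/= => /negP kr; rewrite fr.
rewrite esum_fset; [|exact: finite_seq|by move=> k _; rewrite lee_fin].
by rewrite -fsbig_seq// sumEFin.
Qed.

Lemma count_points_seq tau A w n : count_points tau A w = n%:R%:E ->
  exists r : seq nat, [/\ uniq r, size r = n & forall k, k \in r <-> A (tau k w)].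
Proof.
move=> cn; have /finite_seqP[s sE] : finite_set [set k | A (tau k w)].
  by move: cn; rewrite /count_points /counting; case: ifPn => // /asboolP.
have rA k : k \in undup s <-> A (tau k w).
  by rewrite mem_undup; change ([set` s] k <-> A (tau k w)); rewrite -sE.
exists (undup s); split => //; first exact: undup_uniq.
move: cn; rewrite count_pointsE (@nneseries_fin_support (undup s)) ?undup_uniq//.
  rewrite big_seq (eq_bigr (fun=> 1%R)); last by move=> k /rA kA; rewrite indicE mem_set.
  by rewrite -big_seq big_const_seq count_predT iter_addr_0 => -[/eqP]; rewrite eqr_nat => /eqP.
by move=> k /negP kr; rewrite indicE memNset// => /rA.
Qed.

End CountPoints.

Section SigmaOf.
Context {d : measure_display} {T : measurableType d} {R : realType}.
Variable X : nat -> T -> R.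

Let G : set (set T) := [set E | exists k (B : set R), measurable B /\ E = X k @^-1` B].
Local Notation S := (g_sigma_algebraType G).

Lemma measurable_fun_sigma_of k : measurable_fun setT (X k : S -> R).
Proof.
move=> _ B mB; rewrite setTI; apply: sub_sigma_algebra.
by exists k, B.
Qed.

Lemma sigma_of_count_points (A : set R) (B : set (\bar R)) :
  measurable A -> measurable B -> sigma_of X (count_points X A @^-1` B).
Proof.
move=> mA mB.
have := @measurable_count_points _ S R X A mA measurable_fun_sigma_of.
by move=> /(_ measurableT _ mB); rewrite setTI.
Qed.

Lemma sigma_of_preimage k (B : set R) : measurable B -> sigma_of X (X k @^-1` B).
Proof.
by move=> mB; have := measurable_fun_sigma_of k measurableT mB; rewrite setTI.
Qed.

Lemma sigma_ofI (E F : set T) : sigma_of X E -> sigma_of X F -> sigma_of X (E `&` F).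
Proof. exact: (@measurableI _ S). Qed.

Lemma sigma_of_bigcap (I : choiceType) (D : set I) (F : I -> set T) :
  finite_set D -> (forall i, D i -> sigma_of X (F i)) ->
  sigma_of X (\bigcap_(i in D) F i).
Proof. exact: (@fin_bigcap_measurable _ S). Qed.

Lemma sigma_of_measurable (E : set T) : (forall k, measurable_fun setT (X k)) ->
  sigma_of X E -> measurable E.
Proof.
move=> mX; apply: smallest_sub; first exact: sigma_algebra_measurable.
by move=> _ [k [B [mB ->]]]; rewrite -(setTI (_ @^-1` _)); exact: mX.
Qed.

End SigmaOf.

Section Campbell.
Local Open Scope ereal_scope.
Context {d : measure_display} {T : measurableType d} {R : realType}.
Variables (P : probability T R) (law : probability R R).
Variables (tau a : nat -> {RV P >-> R}) (s2 : R).
Hypothesis a_law : forall k (B : set R), measurable B ->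
  distribution P (a k) B = law B.
Hypothesis tau_a : independent_sequences P (fun k => tau k : T -> R)
                                           (fun k => a k : T -> R).
Hypothesis law_s2 : \int[law]_x (x ^+ 2)%:E = s2%:E.
Local Notation tau' := (fun k => tau k : T -> R).

Let mtau k : measurable_fun setT (tau k). Proof. exact: measurable_funP. Qed.
Let ma k : measurable_fun setT (a k). Proof. exact: measurable_funP. Qed.

Let msqr : measurable_fun setT (fun x : R => (x ^+ 2)%:E).
Proof. by apply/measurable_EFinP; exact: measurable_funX. Qed.

Lemma integral_sqr_mark k (E : set T) : sigma_of tau' E ->
  \int[P]_(w in E) (a k w ^+ 2)%:E = s2%:E * P E.
Proof.
move=> sE; have mE := sigma_of_measurable mtau sE.
have sq0 (x : R) : 0 <= (x ^+ 2)%:E by rewrite lee_fin sqr_ge0.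
have msa : measurable_fun setT (fun w => (a k w ^+ 2)%:E).
  exact: (measurableT_comp msqr).
rewrite (@eq_measure_integral _ _ _ E (mrestr P mE)); last first.
  by move=> A mA AE; rewrite /= /mrestr/= setIidl.
have -> : \int[mrestr P mE]_(w in E) (a k w ^+ 2)%:E =
          \int[mrestr P mE]_w (a k w ^+ 2)%:E.
  rewrite (@ge0_negligible_integral _ _ _ (mrestr P mE) setT (~` E))//.
  - by rewrite setTD setCK.
  - exact: measurableC.
  - by rewrite /= /mrestr/= setICl measure0.
transitivity (\int[pushforward (mrestr P mE) (a k)]_x (x ^+ 2)%:E).
  by rewrite ge0_integral_pushforward.
have PE0 : (0 <= fine (P E))%R by rewrite fine_ge0.
rewrite (@eq_measure_integral _ _ _ setT (mscale (NngNum PE0) law)).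
  rewrite ge0_integral_mscale; [|exact: measurableT|exact: msqr|by []].
  by rewrite law_s2 -[X in (X * _)%E]/((fine (P E))%:E) fineK ?fin_num_measure// muleC.
move=> A mA _; rewrite -[RHS]/((fine (P E))%:E * law A) fineK ?fin_num_measure//.
rewrite -[LHS]/(P (a k @^-1` A `&` E)) -(a_law k mA) setIC tau_a//.
exact: (@sigma_of_preimage _ _ _ (fun k => a k : T -> R)).
Qed.

Definition sqr_marks (C : set R) (w : T) : \bar R :=
  \sum_(k <oo) (\1_C (tau k w) * a k w ^+ 2)%:E.

Lemma sqr_marks_ge0 C w : 0 <= sqr_marks C w.
Proof. by apply: nneseries_ge0 => k _ _; rewrite lee_fin mulr_ge0// sqr_ge0. Qed.

Lemma measurable_sqr_marks C : measurable C -> measurable_fun setT (sqr_marks C).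
Proof.
move=> mC; rewrite (_ : sqr_marks C = fun w =>
    \sum_(0 <= k <oo | k \in xpredT) (\1_C (tau k w) * a k w ^+ 2)%:E)//.
apply: ge0_emeasurable_sum => [k w _ _|k _].
  by rewrite lee_fin mulr_ge0// sqr_ge0.
apply/measurable_EFinP; apply: measurable_funM; last exact: measurable_funX.
by apply: measurableT_comp (mtau k); exact: measurable_indic.
Qed.

Lemma campbell (C : set R) (E : set T) n : sigma_of tau' E -> measurable C ->
  (forall w, E w -> count_points tau' C w = n%:R%:E) ->
  \int[P]_(w in E) sqr_marks C w = (n%:R * s2)%:E * P E.
Proof.
move=> sE mC En; have mE := sigma_of_measurable mtau sE.
have sEk k : sigma_of tau' (E `&` tau k @^-1` C).
  by apply: sigma_ofI => //; exact: (@sigma_of_preimage _ _ _ tau').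
have m1 k : measurable_fun setT (fun w => (\1_C (tau k w))%:E : \bar R).
  apply/measurable_EFinP; apply: measurableT_comp (mtau k).
  exact: measurable_indic.
transitivity (\sum_(k <oo) \int[P]_(w in E) (\1_C (tau k w) * a k w ^+ 2)%:E).
  rewrite integral_nneseries// => k.
    apply: measurable_funTS; apply/measurable_EFinP.
    apply: measurable_funM; last exact: measurable_funX.
    by apply/measurable_EFinP; exact: m1.
  by move=> w _; rewrite lee_fin mulr_ge0// sqr_ge0.
transitivity (\sum_(k <oo) (s2%:E * \int[P]_(w in E) (\1_C (tau k w))%:E)).
  apply: eq_eseriesr => k _.
  rewrite (_ : \int[P]_(w in E) (\1_C (tau k w))%:E = P (E `&` tau k @^-1` C)).
    rewrite -(integral_sqr_mark k (sEk k)) integral_mkcondr; apply: eq_integral => w _.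
    rewrite patchE /= indicE (_ : (w \in _) = (tau k w \in C)).
      by case: ifP; rewrite ?mul1r ?mul0r.
    by apply/idP/idP; rewrite !inE.
  have mk : measurable (tau k @^-1` C).
    by rewrite -(setTI (_ @^-1` _)); exact: mtau.
  rewrite setIC -(integral_indic P mE mk); apply: eq_integral => w _.
  by rewrite !indicE; congr (_%:R%:E); apply/idP/idP; rewrite !inE.
rewrite nneseriesZl; last by move=> k _; exact: integral_ge0.
rewrite -integral_nneseries//; last by move=> k; apply: measurable_funTS; exact: m1.
have -> : \int[P]_(w in E) \sum_(k <oo) (\1_C (tau k w))%:E = n%:R%:E * P E.
  rewrite -integral_cst//; apply: eq_integral => w; rewrite inE => /En <-.
  by rewrite count_pointsE.
by rewrite muleA -EFinM mulrC.
Qed.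

Lemma sqr_marks_seq (C : set R) (w : T) n : count_points tau' C w = n%:R%:E ->
  exists r : seq nat, [/\ uniq r, size r = n, forall k, k \in r <-> C (tau k w) &
    sqr_marks C w = (\sum_(k <- r) a k w ^+ 2)%:E].
Proof.
move=> /count_points_seq[r [ur sr rC]]; exists r; split => //.
rewrite /sqr_marks (@nneseries_fin_support _ r)//.
- congr EFin; rewrite !big_seq; apply: eq_bigr => k /rC kr.
  by rewrite indicE mem_set// mul1r.
- by move=> k; rewrite mulr_ge0// sqr_ge0.
- move=> k /negP kr; rewrite indicE memNset ?mul0r//.
  by move=> /rC.
Qed.

End Campbell.

Section LowerIntegral.
Local Open Scope ereal_scope.
Context {d : measure_display} {T : measurableType d} {R : realType}.
Variable mu : {measure set T -> \bar R}.

(* The integral of a nonnegative function is a supremum over simple minorants,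
   so it is monotone even when the functions are not measurable. *)
Lemma ge0_le_integralT (f g : T -> \bar R) : (forall x, 0 <= f x) ->
  (forall x, f x <= g x) -> \int[mu]_x f x <= \int[mu]_x g x.
Proof.
move=> f0 fg; rewrite !ge0_integralTE//; last by move=> x; exact: le_trans (fg x).
apply: le_ereal_sup => _ [h hf <-]; exists h => // x.
exact: le_trans (hf x) (fg x).
Qed.

Lemma ge0_le_integral_off_null (f g : T -> \bar R) (N : set T) :
  (forall x, 0 <= f x) -> (forall x, 0 <= g x) -> measurable_fun setT g ->
  measurable N -> mu N = 0 -> (forall x, ~ N x -> f x <= g x) ->
  \int[mu]_x f x <= \int[mu]_x g x.
Proof.
move=> f0 g0 mg mN N0 fg.
pose g' x := g x + +oo * (\1_N x)%:E.
have -> : \int[mu]_x g x = \int[mu]_x g' x.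
  have mN' : measurable_fun setT (fun x => (\1_N x)%:E : \bar R).
    by apply/measurable_EFinP; exact: measurable_indic.
  rewrite /g' ge0_integralD//; last exact: measurable_funeM.
  by rewrite ge0_integralZl// integral_indic// setIT N0 mule0 adde0.
apply: ge0_le_integralT => // x; rewrite /g' indicE; have [xN|] := boolP (x \in N).
  by rewrite mule1 addey ?leey// gt_eqF// (lt_le_trans _ (g0 x)).
by rewrite notin_setE mule0 adde0 => /fg.
Qed.

End LowerIntegral.

Section DyadicSets.
Context {R : realType}.
Implicit Types (q L j k m : nat) (x : R).
Local Notation dyad := (@dyad R).

Definition dyadic_itv q m : set R := `]dyad q m, dyad q m.+1]%classic.

Definition mid_half j k : set R :=
  `[dyad j k + 2^-1 ^+ j / 4, dyad j k.+1 - 2^-1 ^+ j / 4]%classic.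

Definition mid_halves q L : set R := \bigcup_(k in `I_(2 ^ L)) mid_half (q + L) k.

Lemma dyadic_itv_inj q m m' x : dyadic_itv q m x -> dyadic_itv q m' x -> m = m'.
Proof.
rewrite /dyadic_itv/= !in_itv/= => /andP[h1 h2] /andP[h3 h4].
have := lt_le_trans h1 h4; have := lt_le_trans h3 h2.
by rewrite !dyad_lt; lia.
Qed.

Let h0 j : 0 < 2^-1 ^+ j :> R. Proof. by rewrite exprn_gt0. Qed.

Lemma mid_half_sub j k : mid_half j k `<=` dyadic_itv j k.
Proof.
move=> x; rewrite /mid_half /dyadic_itv/= !in_itv/= dyad_succ.
by have := h0 j; lra.
Qed.

Lemma mid_halves_sub q L : mid_halves q L `<=` dyadic_itv q 0.
Proof.
move=> x [k /= kL /mid_half_sub]; rewrite /dyadic_itv/= !in_itv/= => /andP[h1 h2].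
have [] := @dyad_coarse R L q k; rewrite divn_small// => h3 h4.
by rewrite (le_lt_trans h3 h1) (le_trans h2 h4).
Qed.

Lemma measurable_mid_halves q L : measurable (mid_halves q L).
Proof. by apply: bigcup_measurable => k _; exact: measurable_itv. Qed.

Lemma lebesgue_measure_mid_halves q L :
  lebesgue_measure (mid_halves q L) = (2^-1 ^+ q / 2)%:E.
Proof.
rewrite /mid_halves bigcup_mkord measure_bigsetU//; last 2 first.
- by move=> k; exact: measurable_itv.
- move=> k k' _ _ [x [/mid_half_sub xk /mid_half_sub xk']].
  exact: dyadic_itv_inj xk xk'.
rewrite (eq_bigr (fun=> (2^-1 ^+ (q + L) / 2)%:E)); last first.
  move=> k _; rewrite [LHS]lebesgue_measure_itv/= lte_fin dyad_succ.
  have hh := h0 (q + L); rewrite ifT; last by lra.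
  by rewrite -EFinB; congr EFin; lra.
rewrite sumEFin; congr EFin; rewrite sumr_const card_ord -[LHS]mulr_natl natrX exprD.
by rewrite !exprVn; field; rewrite !expf_neq0.
Qed.

Lemma lebesgue_measure_dyadic_itv q m :
  lebesgue_measure (dyadic_itv q m) = (2^-1 ^+ q)%:E.
Proof.
rewrite [LHS]lebesgue_measure_itv/= lte_fin dyad_lt ltnSn.
by rewrite dyad_succ -EFinB; congr EFin; lra.
Qed.

Definition cell q L i : set R :=
  if i is m.+1 then
    if m is _.+1 then dyadic_itv q m else dyadic_itv q 0 `\` mid_halves q L
  else mid_halves q L.

Definition cell_measure q i : R := 2^-1 ^+ q / (if (i < 2)%N then 2 else 1).

Lemma measurable_cell q L i : measurable (cell q L i).
Proof.
case: i => [|[|m]]; rewrite /cell; first exact: measurable_mid_halves.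
  by apply: measurableD; [exact: measurable_itv|exact: measurable_mid_halves].
exact: measurable_itv.
Qed.

Lemma cell_sub q L i : cell q L i `<=` dyadic_itv q i.-1.
Proof. by case: i => [|[|m]] //; [exact: mid_halves_sub|move=> x []]. Qed.

Lemma trivIset_cell q L : trivIset setT (cell q L).
Proof.
move=> i j _ _ [x [xi xj]].
have := dyadic_itv_inj (cell_sub xi) (cell_sub xj).
by move: i j xi xj => [|[|i]] [|[|j]]//= h1 h2; [case: h2|case: h1|move=> ->].
Qed.

Lemma lebesgue_measure_cell q L i :
  lebesgue_measure (cell q L i) = (cell_measure q i)%:E.
Proof.
case: i => [|[|m]]; rewrite /cell /cell_measure/=.
- exact: lebesgue_measure_mid_halves.
- have m0 : measurable (dyadic_itv q 0) by exact: measurable_itv.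
  have mm := measurable_mid_halves q L.
  have : (lebesgue_measure (dyadic_itv q 0) =
      lebesgue_measure (dyadic_itv q 0 `\` mid_halves q L) +
      lebesgue_measure (mid_halves q L))%E.
    rewrite -[X in (_ + lebesgue_measure X)%E](setIidr (@mid_halves_sub q L)).
    exact: measureDI.
  rewrite lebesgue_measure_dyadic_itv lebesgue_measure_mid_halves.
  case: (lebesgue_measure _) => [v|//|//].
  rewrite -EFinD => -[h]; congr EFin; move: h (h0 q).
  by move: (2^-1 ^+ q) => u h u0; lra.
by rewrite divr1; exact: lebesgue_measure_dyadic_itv.
Qed.

Lemma cell_measure_gt0 q i : 0 < cell_measure q i.
Proof. by rewrite divr_gt0//; case: ifP. Qed.

Definition dyadic_numbers : set R := [set x | exists j k, x = dyad j k].

Lemma countable_dyadic_numbers : countable dyadic_numbers.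
Proof.
have -> : dyadic_numbers = (fun p : nat * nat => dyad p.1 p.2) @` setT.
  by apply/seteqP; split => [x [j [k ->]]|_ [[j k] _ <-]]; [exists (j, k)|exists j, k].
by apply: card_le_trans (card_image_le _ _) _; exact: countableP.
Qed.

Lemma measurable_dyadic_numbers : measurable dyadic_numbers.
Proof.
apply: countable_measurable => [x|]; first exact: measurable_set1.
exact: countable_dyadic_numbers.
Qed.

End DyadicSets.

(** * The mean-squared error *)

Lemma expn_succ_le (k n : nat) : (n.+1 ^ k <= k ^ k * 2 ^ n)%N.
Proof.
case: k => [|k]; first by rewrite mul1n expn_gt0.
apply: (@leq_trans ((k.+1 * 2 ^ (n %/ k.+1)) ^ k.+1)).
  rewrite leq_exp2r// (leq_trans (ltn_ceil n (ltn0Sn k)))// mulnC leq_mul2l/=.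
  exact: ltn_expl.
by rewrite expnMn leq_mul2l -expnM leq_exp2l// leq_trunc_div orbT.
Qed.

Lemma expn_scale_le (k n M : nat) (J := (M.-1 %/ n.+1)%N) : (0 < M)%N ->
  (M ^ k * n <= (k ^ k * k.+1 ^ k.+1) * (2 ^ n * 2 ^ J))%N.
Proof.
move=> M0; have MJ : (M <= n.+1 * J.+1)%N.
  by rewrite -(prednK M0) mulnC ltn_ceil.
apply: (@leq_trans (n.+1 ^ k.+1 * J.+1 ^ k)).
  apply: (@leq_trans ((n.+1 * J.+1) ^ k * n.+1)).
    by apply: leq_mul; [case: k => // k; rewrite leq_exp2r|].
  by rewrite expnMn expnSr mulnAC.
by rewrite (mulnC (k ^ k)%N) mulnACA leq_mul// expn_succ_le.
Qed.

Section PoissonPmf.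
Context {R : realType}.
Implicit Types r : R.

Lemma poisson_prob_set1 r n : 0 < r ->
  poisson_prob r 0 [set n] = (poisson_pmf r n)%:E.
Proof.
by move=> r0; rewrite /poisson_prob r0 esum_set1//; exact: poisson_pmf_ge0.
Qed.

Lemma poisson_pmf_sum r : 0 < r -> (\sum_(n <oo) (poisson_pmf r n)%:E = 1)%E.
Proof.
move=> r0; rewrite nneseries_esumT; last by move=> n; rewrite lee_fin poisson_pmf_ge0.
transitivity (poisson_prob r 0 setT); first by rewrite /poisson_prob r0.
exact: (probability_setT (poisson_prob r 0)).
Qed.

Lemma poisson_pmf_tilt r n : 0 < r ->
  4 ^+ n * poisson_pmf r n = expR (3 * r) * poisson_pmf (4 * r) n.
Proof.
move=> r0; have r40 : 0 < 4 * r by rewrite mulr_gt0.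
rewrite /poisson_pmf r0 r40 exprMn.
have -> : expR (- r) = expR (3 * r) * expR (- (4 * r)).
  by rewrite -expRD; congr expR; ring.
by ring.
Qed.

Lemma poisson_pmf_gt0 r n : 0 < r -> 0 < poisson_pmf r n.
Proof.
by move=> r0; rewrite /poisson_pmf r0 mulr_gt0 ?expR_gt0// divr_gt0 ?exprn_gt0.
Qed.

End PoissonPmf.

Lemma law_set1_density {R : realType} (law : probability R R) (x : R) :
  has_density law -> law [set x] = 0%E.
Proof.
by move=> [f [_ _ h]]; rewrite h ?integral_set1//; exact: measurable_set1.
Qed.

Section Model.
Context {R : realType} {d : measure_display} {T : measurableType d}.
Variables (P : probability T R) (lambda : R) (law : probability R R).
Variables (tau a : nat -> {RV P >-> R}) (s2 : R).
Hypothesis lambda_gt0 : 0 < lambda.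
Hypothesis cpp : compound_poisson_data law lambda tau a.
Hypothesis law_s2 : (\int[law]_x (x ^+ 2)%:E = s2%:E)%E.
Local Notation tau' := (fun k => tau k : T -> R).
Local Notation path := (compound_poisson tau a).

Let I01 : set R := `]0, 1]%classic.

Let mI01 : measurable I01. Proof. exact: measurable_itv. Qed.

Let poiss : stationary_poisson_process lambda tau. Proof. by case: cpp. Qed.

Let a_law k (B : set R) : measurable B -> distribution P (a k) B = law B.
Proof. by case: cpp => _ [+ _] _; exact. Qed.

Let tau_a : independent_sequences P tau' (fun k => a k : T -> R).
Proof. by case: cpp. Qed.

Let mtau k : measurable_fun setT (tau k). Proof. exact: measurable_funP. Qed.
Let ma k : measurable_fun setT (a k). Proof. exact: measurable_funP. Qed.

Let s2_ge0 : 0 <= s2.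
Proof. by rewrite -lee_fin -law_s2 integral_ge0// => x _; rewrite lee_fin sqr_ge0. Qed.

Lemma compound_poisson_jump_path (r : seq nat) w : uniq r ->
  (forall k, k \in r <-> I01 (tau k w)) ->
  {in `[0, 1]%classic, path w =1 jump_path r (fun k => a k w) (fun k => tau k w)}.
Proof.
move=> ur rE x; rewrite inE/= in_itv/= => /andP[x0 x1].
rewrite /compound_poisson /jump_path.
have -> : [set k | 0 < tau k w <= x] = [set` [seq k <- r | tau k w <= x]].
  apply/seteqP; split => k /=; rewrite mem_filter.
    move=> /andP[k0 kx]; rewrite kx/=; apply/rE; rewrite /I01/= in_itv/= k0.
    exact: le_trans x1.
  by move=> /andP[-> /rE]; rewrite /I01/= in_itv/= => /andP[-> _].
rewrite -fsbig_seq ?filter_uniq// big_filter big_mkcond/=.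
by apply: eq_bigr => k _; rewrite stepE; case: ifP; rewrite ?mulr1 ?mulr0.
Qed.

Let E n : set T := count_points tau' I01 @^-1` [set n%:R%:E].

Let sE n : sigma_of tau' (E n).
Proof. by apply: sigma_of_count_points. Qed.

Let mE n : measurable (E n). Proof. exact: sigma_of_measurable (sE n). Qed.

Let tE : trivIset setT E.
Proof.
move=> i j _ _ [w [/= ]]; rewrite /E/= => -> [/eqP].
by rewrite eqr_nat => /eqP.
Qed.

Let PE n : P (E n) = (poisson_pmf lambda n)%:E.
Proof.
have mu1 : lebesgue_measure I01 = 1%E.
  by rewrite /I01 lebesgue_measure_itv/= lte_fin ltr01 oppr0 adde0.
rewrite -poisson_prob_set1// -[lambda in RHS]mulr1 -[X in lambda * X]/(fine 1%E) -mu1.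
by rewrite -poiss.1// mu1 ltry.
Qed.

Let P_bigcupE : P (\bigcup_n E n) = 1%E.
Proof.
rewrite measure_bigcup//.
rewrite (eq_eseriesr (g := fun n => (poisson_pmf lambda n)%:E)); last first.
  by move=> n _; exact: PE.
by rewrite -(poisson_pmf_sum lambda_gt0); apply: eq_eseriesl => n; apply/asboolP.
Qed.

Let H w : \bar R :=
  (\sum_(n <oo) ((2 ^+ n)%:E * (\1_(E n) w)%:E * sqr_marks tau a I01 w))%E.

Let H0 n w : (0 <= (2 ^+ n)%:E * (\1_(E n) w)%:E * sqr_marks tau a I01 w)%E.
Proof. by rewrite mule_ge0 ?sqr_marks_ge0// lee_fin mulr_ge0// exprn_ge0. Qed.

Let mHn n : measurable_fun setT
  (fun w => (2 ^+ n)%:E * (\1_(E n) w)%:E * sqr_marks tau a I01 w)%E.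
Proof.
apply: emeasurable_funM; last exact: measurable_sqr_marks.
apply: measurable_funeM; apply/measurable_EFinP; exact: measurable_indic.
Qed.

Let mH : measurable_fun setT H.
Proof.
rewrite (_ : H = fun w => (\sum_(0 <= n <oo | n \in xpredT)
  ((2 ^+ n)%:E * (\1_(E n) w)%:E * sqr_marks tau a I01 w))%E)//.
by apply: ge0_emeasurable_sum.
Qed.

Let intH : (\int[P]_w H w <= (s2 * expR (3 * lambda))%:E)%E.
Proof.
rewrite integral_nneseries//.
rewrite -[leRHS]mule1 -(@poisson_pmf_sum _ (4 * lambda)) ?mulr_gt0//.
rewrite -nneseriesZl; last by move=> n _; rewrite lee_fin poisson_pmf_ge0.
apply: lee_nneseries => n _; first by move=> _; exact: integral_ge0.
have -> : (\int[P]_w ((2 ^+ n)%:E * (\1_(E n) w)%:E * sqr_marks tau a I01 w) =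
    (2 ^+ n)%:E * \int[P]_(w in E n) sqr_marks tau a I01 w)%E.
  rewrite -ge0_integralZl; [|exact: mE|apply: measurable_funTS;
    exact: measurable_sqr_marks|by move=> w _; exact: sqr_marks_ge0
    |by rewrite lee_fin exprn_ge0].
  rewrite [RHS]integral_mkcond; apply: eq_integral => w _.
  by rewrite patchE indicE; case: ifP; rewrite ?mule1// mule0 mul0e.
rewrite (campbell a_law tau_a law_s2 (n := n))//.
rewrite PE -!EFinM lee_fin -[leRHS]mulrA -poisson_pmf_tilt//.
rewrite [leLHS](_ : _ = s2 * (2 ^+ n * n%:R * poisson_pmf lambda n)); last by ring.
rewrite ler_wpM2l// ler_wpM2r ?poisson_pmf_ge0//.
rewrite (_ : 4 = 2 * 2 :> R); last by rewrite -natrM.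
by rewrite exprMn ler_wpM2l ?exprn_ge0// -natrX ler_nat ltnW// ltn_expl.
Qed.

Lemma mse_greedy_le k : exists B : R, forall M, (0 < M)%N ->
  (mse_greedy P path M <= (B / M%:R ^+ k)%:E)%E.
Proof.
pose C k : R := (k ^ k * k.+1 ^ k.+1)%N%:R.
exists (C k * s2 * expR (3 * lambda)) => M M0.
have Mk0 : 0 < M%:R ^+ k :> R by rewrite exprn_gt0 ?ltr0n.
have Ck0 : (0 <= C k / M%:R ^+ k) by rewrite divr_ge0 ?ler0n// ltW.
apply: (@le_trans _ _ (\int[P]_w ((C k / M%:R ^+ k)%:E * H w))%E); last first.
  rewrite ge0_integralZl//; last by move=> w _; exact: nneseries_ge0.
  have -> : C k * s2 * expR (3 * lambda) / M%:R ^+ k =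
            C k / M%:R ^+ k * (s2 * expR (3 * lambda)) by ring.
  by rewrite [X in (_ <= X)%E]EFinM; apply: lee_wpmul2l.
have mU : measurable (\bigcup_n E n) by exact: bigcup_measurable.
apply: (@ge0_le_integral_off_null _ _ _ _ _ _ (~` \bigcup_n E n)).
- by move=> w; apply: integral_ge0 => x _; rewrite lee_fin sqr_ge0.
- by move=> w; rewrite mule_ge0//; exact: nneseries_ge0.
- exact: measurable_funeM.
- exact: measurableC.
- have h : P (~` \bigcup_n E n) = 0%E by rewrite probability_setC// P_bigcupE subee.
  exact: h.
move=> w /contrapT[n _ Ew].
have [r [ur sr rE SE]] := sqr_marks_seq a Ew.
rewrite (sqnorm01_greedy_eq _ (compound_poisson_jump_path ur rE)).
set Q := \sum_(k <- r) a k w ^+ 2 in SE.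
have Q0 : 0 <= Q by apply: sumr_ge0 => i _; exact: sqr_ge0.
have r01 i : i \in r -> 0 < tau i w <= 1 by move/rE; rewrite /I01/= in_itv.
pose J := (M.-1 %/ n.+1)%N.
have JM : (1 + J * size r <= M)%N.
  rewrite sr; have := leq_trunc_div M.-1 n.+1; rewrite -/J; nia.
apply: (le_trans (greedy_error_jump_path_le (fun k => a k w) r01 JM)).
apply: (@le_trans _ _ ((C k / M%:R ^+ k)%:E * (2 ^+ n * Q)%:E)%E).
  rewrite -EFinM lee_fin sr -/Q.
  have := expn_scale_le k n M0.
  rewrite -/J -(ler_nat R) [X in X <= _ -> _]natrM natrX.
  rewrite [X in _ <= X -> _]natrM -/(C k) natrM !natrX => h.
  rewrite ler_pdivrMr ?exprn_gt0// -(ler_pM2l Mk0).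
  rewrite [leLHS]mulrA [leRHS](_ : _ = C k * (2 ^+ n * 2 ^+ J) * Q).
    exact: ler_wpM2r.
  by field; rewrite gt_eqF.
apply: lee_wpmul2l; first by rewrite lee_fin.
rewrite /H (nneseriesD1 (n := n))//.
rewrite indicE mem_set// mule1 SE -EFinM leeDl//.
by apply: nneseries_ge0 => m *; rewrite -SE; exact: H0.
Qed.

Hypothesis law_density : has_density law.

Lemma law_s2_gt0 : 0 < s2.
Proof.
have sq0 (x : R) : (0 <= (x ^+ 2)%:E)%E by rewrite lee_fin sqr_ge0.
rewrite lt_neqAle -lee_fin -law_s2 integral_ge0// andbT eq_sym.
apply/eqP => s0; move: law_s2; rewrite s0 => i0.
have msq : measurable_fun setT (fun x : R => (x ^+ 2)%:E).
  by apply/measurable_EFinP; exact: measurable_funX.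
have : (\int[law]_x `|(x ^+ 2)%:E| = 0)%E.
  by apply: etrans i0; apply: eq_integral => x _; rewrite gee0_abs.
move/(ae_eq_integral_abs law measurableT msq) => [N [mN N0 sN]].
have : (law (~` [set 0%R]) <= law N)%E.
  have m0 : measurable (~` [set (0 : R)]) by apply: measurableC; exact: measurable_set1.
  apply: le_measure; rewrite ?inE//.
  move=> x /= x0; apply: sN => /= /(_ I)/= => -[/eqP].
  by rewrite sqrf_eq0 => /eqP.
rewrite N0 probability_setC; last exact: measurable_set1.
by rewrite law_set1_density// sube0 lee_fin ler10.
Qed.

Let N : set T := \bigcup_k (a k @^-1` [set 0]).

Let mN : measurable N.
Proof.
apply: bigcup_measurable => k _; rewrite -(setTI (_ @^-1` _)).
by apply: ma => //; exact: measurable_set1.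
Qed.

Let PN : P N = 0%E.
Proof.
apply/(negligibleP P mN); apply: negligible_bigcup => k.
apply/negligibleP.
  by rewrite -(setTI (_ @^-1` _)); apply: ma => //; exact: measurable_set1.
rewrite -[LHS]/(distribution P (a k) [set 0]) a_law ?law_set1_density//.
Qed.

(* Each dyadic interval of level q carries exactly one jump, and the jump in the
   first one avoids the ends of the intervals of level q + L, which makes one
   coefficient at that level of the largest possible order 2^(-(q + L) / 2). *)
Let one_per_cell q L : set T :=
  \bigcap_(i in [set` fset_set `I_(2 ^ q).+1])
    (count_points tau' (cell q L i) @^-1` [set (i != 1)%:R%:E]).

Definition one_per_cell_prob q : R :=
  \prod_(i <- fset_set `I_(2 ^ q).+1)
    poisson_pmf (lambda * cell_measure q i) (i != 1).

Lemma one_per_cell_prob_gt0 q : 0 < one_per_cell_prob q.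
Proof.
rewrite /one_per_cell_prob; apply: prodr_gt0 => i _.
by apply: poisson_pmf_gt0; rewrite mulr_gt0 ?cell_measure_gt0.
Qed.

Let P_one_per_cell q L : P (one_per_cell q L) = (one_per_cell_prob q)%:E.
Proof.
have fin i : (lebesgue_measure (cell q L i) < +oo :> \bar R)%E.
  by rewrite [X in (X < _)%E]lebesgue_measure_cell ltry.
have := poiss.2 _ (@measurable_cell R q L) fin (@trivIset_cell R q L).
move=> /(_ (fset_set `I_(2 ^ q).+1) (fun i => [set (i != 1)%:R%:E])) -> //.
rewrite /one_per_cell_prob.
rewrite (big_morph (@EFin R) (@EFinM R) erefl).
apply: eq_bigr => i _.
have v0 : 0 < lambda * cell_measure q i by rewrite mulr_gt0// cell_measure_gt0.
rewrite -(poisson_prob_set1 _ v0).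
have -> : cell_measure q i = fine (lebesgue_measure (cell q L i)) :> R.
  by rewrite [X in fine X]lebesgue_measure_cell.
by rewrite -poiss.1//; exact: measurable_cell.
Qed.

Let no_dyadic : set T := count_points tau' (@dyadic_numbers R) @^-1` [set 0%:R%:E].

Let P_no_dyadic : P no_dyadic = 1%E.
Proof.
have mD := @measurable_dyadic_numbers R.
have D0 := countable_lebesgue_measure0 (@countable_dyadic_numbers R).
have := poiss.1 _ 0%N mD; rewrite D0 => /(_ (ltry _)) => ->.
by rewrite /= mulr0 /poisson_prob ltxx diracE mem_set.
Qed.

Let good q L := one_per_cell q L `&` no_dyadic.

Let s_no_dyadic : sigma_of tau' no_dyadic.
Proof. by apply: sigma_of_count_points => //; exact: measurable_dyadic_numbers. Qed.

Let s_one_per_cell q L : sigma_of tau' (one_per_cell q L).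
Proof.
apply: sigma_of_bigcap => // i _; apply: sigma_of_count_points => //.
exact: measurable_cell.
Qed.

Let s_good q L : sigma_of tau' (good q L).
Proof. exact: sigma_ofI. Qed.

Let P_good q L : P (good q L) = (one_per_cell_prob q)%:E.
Proof.
have m1 := sigma_of_measurable mtau (s_one_per_cell q L).
have m2 := sigma_of_measurable mtau s_no_dyadic.
have Z : P (one_per_cell q L `\` no_dyadic) = 0%E.
  apply/eqP; rewrite eq_le measure_ge0 andbT.
  have <- : P (~` no_dyadic) = 0%E by rewrite probability_setC// P_no_dyadic subee.
  have mD : measurable (one_per_cell q L `\` no_dyadic) by exact: measurableD.
  have mC : measurable (~` no_dyadic) by exact: measurableC.
  by apply: le_measure; rewrite ?inE//; move=> w [].
have DI : P (one_per_cell q L) =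
  (P (one_per_cell q L `\` no_dyadic) + P (good q L))%E := measureDI P m1 m2.
by rewrite -(P_one_per_cell q L) DI Z add0e.
Qed.

Let greedy_error_good q L M w : (M <= L * 2 ^ q)%N -> good q L w -> ~ N w ->
  ((16 * 2 ^+ (q + L))^-1%:E * sqr_marks tau a (mid_halves q L) w <=
   sqnorm01 (fun x => path w x - greedy M (path w) x)%R)%E.
Proof.
move=> ML [Cw Dw] Nw.
have cellP i : (i <= 2 ^ q)%N ->
    count_points tau' (cell q L i) w = (i != 1)%:R%:E.
  by move=> iq; apply: Cw; rewrite /= in_fset_set// inE.
have nd k j m : tau k w != @dyad R j m.
  have [r [_ /size0nil r0 rD]] := count_points_seq Dw.
  apply/eqP => tjm; have /rD : @dyadic_numbers R (tau k w) by exists j, m.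
  by rewrite r0.
have [k0 [k0C k0u SE]] : exists k0, [/\ mid_halves q L (tau k0 w),
    forall k, mid_halves q L (tau k w) -> k = k0 &
    sqr_marks tau a (mid_halves q L) w = (a k0 w ^+ 2)%:E].
  have [r [ur sr rC SE]] := sqr_marks_seq a (cellP 0%N (leq0n _)).
  move: r ur sr rC SE => [|k0 []]//= _ _ rC SE; exists k0; split.
  - by apply/rC; rewrite inE.
  - by move=> k /rC; rewrite inE => /eqP.
  - by rewrite SE big_seq1.
have sep m : (m < 2 ^ q)%N -> exists2 i, dyadic_itv q m (tau i w) &
    forall i', dyadic_itv q m (tau i' w) -> i' = i.
  case: m => [_|m mq].
    exists k0; first exact: mid_halves_sub k0C.
    move=> i' i'0; apply: k0u; apply: contrapT => i'C.
    have [|r [_ /size0nil r0 rC]] := @count_points_seq _ _ _ tau' _ _ _ (cellP 1%N _).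
      by rewrite expn_gt0.
    by have /rC : cell q L 1 (tau i' w) by []; rewrite r0.
  have [r [_ sr rC]] := count_points_seq (cellP m.+2 mq).
  move: r sr rC => [|i []]//= _ rC; exists i; first by apply/rC; rewrite inE.
  by move=> i' /rC; rewrite inE => /eqP.
have loc k : 0 < tau k w <= 1 -> exists2 m, (m < 2 ^ q)%N & dyadic_itv q m (tau k w).
  move=> /andP[/ltW t0 t1]; have [|m [mq /andP[h1 h2] _]] := @step_energy R q (tau k w).
    by rewrite t0.
  exists m => //; rewrite /dyadic_itv/= in_itv/= h2 andbT.
  by rewrite lt_neqAle h1 eq_sym nd.
have sub01 m x : (m < 2 ^ q)%N -> @dyadic_itv R q m x -> 0 < x <= 1.
  move=> mq; rewrite /dyadic_itv/= in_itv/= => /andP[h1 h2].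
  by rewrite (le_lt_trans (dyad_ge0 _ _) h1) (le_trans h2)// dyad_le1.
have fK : finite_set [set k | 0 < tau k w <= 1].
  pose h m := get [set k | dyadic_itv q m (tau k w)].
  apply: (@sub_finite_set _ _ (h @` `I_(2 ^ q))); last exact/finite_image/finite_II.
  move=> k /loc[m mq km]; exists m => //; have [i _ iu] := sep _ mq.
  rewrite (iu _ km); apply: iu.
  by apply: (@getPex _ [set k | dyadic_itv q m (tau k w)]); exists k.
have /finite_seqP[s Ks] := fK.
have rE k : k \in undup s <-> 0 < tau k w <= 1.
  by rewrite mem_undup; change ([set` s] k <-> 0 < tau k w <= 1); rewrite -Ks.
have ur := undup_uniq s; set r := undup s in rE ur.
have rI k : k \in r <-> I01 (tau k w) by rewrite rE /I01/= in_itv.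
rewrite (sqnorm01_greedy_eq _ (compound_poisson_jump_path ur rI)).
have [k /= kL k0k] := k0C.
have kqL : (k < 2 ^ (q + L))%N.
  by rewrite (leq_trans kL)// leq_exp2l// leq_addl.
rewrite SE -EFinM mulrC.
apply: (@greedy_error_jump_path_ge _ _ _ _ _ q ur _ _ _ M L k0 k) => //.
- by move=> i /rE.
- by move=> i _; apply/eqP => ai; apply: Nw; exists i.
- move=> m mq; have [i im iu] := sep _ mq; exists i.
    split; first by apply/rE; exact: sub01 im.
    by move: im; rewrite /dyadic_itv/= in_itv.
  by move=> i' _ h; apply: iu; rewrite /dyadic_itv/= in_itv.
- apply/rE; apply: (sub01 0%N); first by rewrite expn_gt0.
  exact: mid_halves_sub k0C.
Qed.

Lemma mse_greedy_ge q L M : (M <= L * 2 ^ q)%N ->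
  ((s2 * one_per_cell_prob q / (16 * 2 ^+ (q + L)))%:E <= mse_greedy P path M)%E.
Proof.
move=> ML; have mg := sigma_of_measurable mtau (s_good q L).
have mC := @measurable_mid_halves R q L.
have mS := measurable_sqr_marks tau a mC.
set c := (16 * 2 ^+ (q + L))^-1.
have c0 : 0 <= c by rewrite invr_ge0 mulr_ge0// exprn_ge0.
have cS0 w : (0 <= c%:E * sqr_marks tau a (mid_halves q L) w)%E.
  by rewrite mule_ge0 ?sqr_marks_ge0.
have -> : (s2 * one_per_cell_prob q / (16 * 2 ^+ (q + L)))%:E =
    (\int[P]_(w in good q L `\` N) (c%:E * sqr_marks tau a (mid_halves q L) w))%E.
  rewrite -ge0_negligible_integral//; last by apply: measurable_funeM; exact: measurable_funTS.
  rewrite ge0_integralZl//; last 2 first.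
  - exact: measurable_funTS.
  - by move=> w _; exact: sqr_marks_ge0.
  rewrite (campbell a_law tau_a law_s2 (n := 1))//; last first.
    by move=> w [Cw _]; apply: (Cw 0%N); rewrite /= in_fset_set// inE.
  by rewrite P_good -!EFinM mul1r mulrC.
rewrite integral_mkcond; apply: ge0_le_integralT => w.
  by apply: erestrict_ge0 => w' _.
rewrite patchE; case: ifPn => [|_].
  by rewrite inE => -[gw Nw]; exact: greedy_error_good.
by apply: integral_ge0 => x _; rewrite lee_fin sqr_ge0.
Qed.

End Model.

Lemma second_moment_fin {R : realType} (law : probability R R) :
  ('E_law[idfun] = 0)%E -> ('V_law[idfun] < +oo)%E ->
  exists s2 : R, (\int[law]_x (x ^+ 2)%:E = s2%:E)%E.
Proof.
move=> E0; rewrite /variance covariance.unlock E0 expectation.unlock => V.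
exists (fine (\int[law]_x (x ^+ 2)%:E)); rewrite fineK// ge0_fin_numE; last first.
  by apply: integral_ge0 => x _; rewrite lee_fin sqr_ge0.
congr (_ < _)%E: V; apply: eq_integral => x _; congr EFin.
by rewrite /= /GRing.mul/= subr0 expr2.
Qed.

Lemma cvg_div_nat {R : realType} (B : R) :
  (fun M : nat => (B / M%:R)%:E) @ \oo --> 0%E.
Proof.
apply: cvg_EFin; first by apply: nearW.
have : (cst B \* @harmonic R) @ \oo --> B * 0.
  by apply: cvgM; [exact: cvg_cst|exact: cvg_harmonic].
by rewrite mulr0 -[X in _ -> X]cvg_shiftS.
Qed.

Lemma expR_div_expn_ge {R : realType} (alpha : R) (Q M : nat) :
  0 < alpha -> (0 < Q)%N -> 2 <= alpha * Q%:R ->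
  alpha / 4 * M%:R <= expR (alpha * M%:R) / 2 ^+ (M %/ Q).+1.
Proof.
move=> a0 Q0 aQ; set L := (M %/ Q)%N.
have LM : (L * Q)%:R <= M%:R :> R by rewrite ler_nat leq_trunc_div.
have e2 : 2 ^+ L <= expR (L%:R) :> R.
  rewrite -[L%:R]mulr1 expRM_natl lerXn2r ?nnegrE ?expR_ge0//.
  by rewrite (le_trans _ (expR_ge1Dx 1)).
have eL : expR (L%:R) <= expR (alpha * M%:R / 2).
  rewrite ler_expR ler_pdivlMr// (@le_trans _ _ (L%:R * (alpha * Q%:R)))//.
    by rewrite ler_wpM2l.
  by rewrite mulrCA -natrM ler_wpM2l// ltW.
rewrite ler_pdivlMr ?exprn_gt0// exprS.
have -> : expR (alpha * M%:R) = expR (alpha * M%:R / 2) * expR (alpha * M%:R / 2).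
  by rewrite -expRD; congr expR; field.
have := expR_ge1Dx (alpha * M%:R / 2).
have : 0 <= alpha * M%:R by rewrite mulr_ge0 ?ler0n// ltW.
move=> aM h; have {e2}e2 := le_trans e2 eL.
have L0 : 0 <= (2 : R) ^+ L by rewrite exprn_ge0.
apply: (@le_trans _ _ (alpha / 4 * M%:R * (2 * expR (alpha * M%:R / 2)))).
  by rewrite ler_wpM2l ?ler_wpM2l//; lra.
rewrite mulrA ler_wpM2r ?expR_ge0//; lra.
Qed.

Theorem theorem2 (R : realType) (d : measure_display) (T : measurableType d)
    (P : probability T R) (lambda : R) (law : probability R R)
    (tau a : nat -> {RV P >-> R})
    (lambda_gt0 : 0 < lambda)
    (law_density : has_density law)
    (law_mean : ('E_law[idfun] = 0)%E)
    (law_variance : ('V_law[idfun] < +oo)%E)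
    (cpp : compound_poisson_data law lambda tau a) :
  (forall k : nat,
     (fun M : nat =>
        ((M%:R ^+ k)%:E * mse_greedy P (compound_poisson tau a) M)%E) @ \oo
       --> 0%E) /\
  (forall alpha : R, 0 < alpha ->
     (fun M : nat =>
        ((expR (alpha * M%:R))%:E
           * mse_greedy P (compound_poisson tau a) M)%E) @ \oo
       --> +oo%E).
Proof.
have [s2 law_s2] := second_moment_fin law_mean law_variance.
split=> [k|alpha alpha0].
  have [B mseB] := mse_greedy_le lambda_gt0 cpp law_s2 k.+1.
  apply: (@squeeze_cvge _ _ _ _ (cst 0%E) _ (fun M => (B / M%:R)%:E));
    [|exact: cvg_cst|exact: cvg_div_nat].
  exists 1%N => // M /= M0; have MR0 : 0 < M%:R :> R by rewrite ltr0n.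
  rewrite mule_ge0 ?lee_fin ?exprn_ge0//=; last first.
    by apply: integral_ge0 => w _; apply: integral_ge0 => x _; rewrite lee_fin sqr_ge0.
  apply: (le_trans (lee_wpmul2l _ (mseB _ M0))); first by rewrite lee_fin exprn_ge0.
  rewrite -EFinM lee_fin exprS.
  by rewrite le_eqVlt; apply/orP; left; apply/eqP; field; rewrite !gt_eqF ?exprn_gt0.
pose q := (Num.truncn (2 / alpha)).+1.
have aq : 2 <= alpha * (2 ^ q)%:R.
  rewrite mulrC -ler_pdivrMr//.
  have /andP[_ /ltW h] := truncn_itv (divr_ge0 (ler0n R 2) (ltW alpha0)).
  by rewrite (le_trans h)// ler_nat -/q ltnW// ltn_expl.
have s0 := law_s2_gt0 law_s2 law_density.
have p0 := one_per_cell_prob_gt0 lambda_gt0 q.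
pose K := s2 * one_per_cell_prob lambda q / (16 * 2 ^+ q) * (alpha / 4).
have K0 : 0 < K by rewrite !(mulr_gt0, invr_gt0, exprn_gt0).
apply/cvgeyPge => A; exists (Num.truncn (`|A| / K)).+1 => // M /= AM.
apply: (@le_trans _ _ ((expR (alpha * M%:R))%:E *
  (s2 * one_per_cell_prob lambda q / (16 * 2 ^+ (q + (M %/ 2 ^ q).+1)))%:E)%E); last first.
  apply: lee_wpmul2l; first by rewrite lee_fin expR_ge0.
  apply: (mse_greedy_ge lambda_gt0 cpp law_s2 law_density).
  by rewrite ltnW// ltn_ceil// expn_gt0.
rewrite -EFinM lee_fin (le_trans (ler_norm A))//.
apply: (@le_trans _ _ (K * M%:R)).
  rewrite mulrC -ler_pdivrMr//.
  have /andP[_ /ltW h'] := truncn_itv (divr_ge0 (normr_ge0 A) (ltW K0)).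
  by rewrite (le_trans h')// ler_nat.
have := @expR_div_expn_ge _ alpha (2 ^ q)%N M alpha0 _ aq; rewrite expn_gt0 => /(_ isT) e.
rewrite /K exprD -mulrA [leRHS](_ : _ = s2 * one_per_cell_prob lambda q / (16 * 2 ^+ q) *
  (expR (alpha * M%:R) / 2 ^+ (M %/ 2 ^ q).+1)).
  by rewrite ler_wpM2l// ltW// !(mulr_gt0, invr_gt0, exprn_gt0).
by field; rewrite !expf_neq0.
Qed.
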